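(* There are universal constants $0<\kappa\le A<\infty$ such that for every $R\ge2$ we have $$\kappa\sqrt{\log R}\le c_{L_2}(B_R)\le A\sqrt{\log R}.$$
   Context: $\mathbb{H}=\langle a,b \mid aba^{-1}b^{-1}\text{ is central}\rangle$ is the discrete Heisenberg group with identity $e$, and $d_W$ is the left-invariant word metric on $\mathbb{H}$ associated to the symmetric generating set $S=\{a,b,a^{-1},b^{-1}\}$. For $R\ge1$, $B_R=\{x\in\mathbb{H}: d_W(e,x)\le R\}$. $L_2$ is Hilbert space with norm $\|\cdot\|_2$. The bi-Lipschitz distortion $c_{L_2}(B_R)$ of $(B_R,d_W)$ in $L_2$ is the infimum over those $D\ge1$ such that there exists $f:B_R\to L_2$ satisfying $d_W(x,y)\le\|f(x)-f(y)\|_2\le D\,d_W(x,y)$ for all $x,y\in B_R$. *)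

(* Defs.v *)
From HB Require Import structures.
From mathcomp Require Import all_boot all_order all_algebra.
From mathcomp Require Import generic_quotient.
From mathcomp Require Import all_classical all_reals all_analysis.

Set Implicit Arguments.
Unset Strict Implicit.
Unset Printing Implicit Defensive.

Import Order.TTheory GRing.Theory Num.Theory.

Local Open Scope classical_set_scope.
Local Open Scope quotient_scope.
Local Open Scope group_scope.

(* [(g, s)] is the letter a (g = false) or b (g = true), inverted iff s. *)
Definition letter : Type := (bool * bool)%type.
Definition letter_inv (l : letter) : letter := (l.1, ~~ l.2).
Definition letter_a : letter := (false, false).
Definition letter_b : letter := (true, false).

Definition word : Type := seq letter.

Definition word_inv (w : word) : word := rev (map letter_inv w).
Definition comm_ab : word :=
  [:: letter_a; letter_b; letter_inv letter_a; letter_inv letter_b].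

(* The congruence on words presenting < a, b | a b a^-1 b^-1 is central >:
   its classes are the elements of the presented group. *)
Inductive heis_cong : word -> word -> Prop :=
| heis_refl u : heis_cong u u
| heis_sym u v : heis_cong u v -> heis_cong v u
| heis_trans u v w : heis_cong u v -> heis_cong v w -> heis_cong u w
| heis_cat u u' v v' :
    heis_cong u u' -> heis_cong v v' -> heis_cong (u ++ v) (u' ++ v')
| heis_cancel l : heis_cong [:: l; letter_inv l] [::]
| heis_central u : heis_cong (comm_ab ++ u) (u ++ comm_ab).

Definition heis_congb (u v : word) : bool := `[< heis_cong u v >].

Lemma heis_congb_refl : reflexive heis_congb.
Proof. by move=> u; apply/asboolP; exact: heis_refl. Qed.

Lemma heis_congb_sym : symmetric heis_congb.
Proof. by move=> u v; apply/idP/idP => /asboolP/heis_sym/asboolP. Qed.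

Lemma heis_congb_trans : transitive heis_congb.
Proof.
by move=> v u w /asboolP uv /asboolP vw; apply/asboolP/(heis_trans uv vw).
Qed.

Canonical heis_congb_equiv :=
  EquivRel heis_congb heis_congb_refl heis_congb_sym heis_congb_trans.

Definition heis : Type := {eq_quot heis_congb}.
HB.instance Definition _ := Choice.on heis.
HB.instance Definition _ := EqQuotient.on heis.

Lemma heis_piP (u v : word) : heis_cong u v <-> \pi_heis u = \pi_heis v.
Proof.
split=> [uv | /eqP]; first by apply/eqP; rewrite eqmodE; apply/asboolP.
by rewrite eqmodE => /asboolP.
Qed.

Definition heis_one : heis := \pi_heis [::].
Definition heis_mul : heis -> heis -> heis := lift_op2 heis cat.
Definition heis_inv : heis -> heis := lift_op1 heis word_inv.

Lemma heis_cong_repr (u : word) : heis_cong (repr (\pi_heis u)) u.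
Proof. by apply/heis_piP; rewrite reprK. Qed.

Lemma heis_mul_pi (u v : word) :
  heis_mul (\pi_heis u) (\pi_heis v) = \pi_heis (u ++ v).
Proof.
rewrite /heis_mul -lock.
by apply/heis_piP; apply: heis_cat; exact: heis_cong_repr.
Qed.

Lemma word_invK : involutive word_inv.
Proof.
move=> w; rewrite /word_inv map_rev revK -map_comp map_id_in// => -[g s] _.
by rewrite /= /letter_inv negbK.
Qed.

Lemma heis_cat_inv (u : word) : heis_cong (u ++ word_inv u) [::].
Proof.
elim: u => [|l u IHu]; first exact: heis_refl.
rewrite /word_inv /= rev_cons -cats1 catA -(cat1s l (_ ++ _)).
apply: heis_trans (heis_cancel l).
exact: heis_cat (heis_refl [:: l]) (heis_cat IHu (heis_refl _)).
Qed.

Lemma heis_inv_cat (u : word) : heis_cong (word_inv u ++ u) [::].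
Proof. by rewrite -{2}[u]word_invK; exact: heis_cat_inv. Qed.

Lemma heis_invE (x : heis) : heis_inv x = \pi_heis (word_inv (repr x)).
Proof. by rewrite /heis_inv -lock. Qed.

Lemma heis_mulA : associative heis_mul.
Proof.
by move=> x y z; rewrite -[x]reprK -[y]reprK -[z]reprK !heis_mul_pi catA.
Qed.

Lemma heis_mul1 : left_id heis_one heis_mul.
Proof. by move=> x; rewrite -[x]reprK heis_mul_pi. Qed.

Lemma heis_mulr1 : right_id heis_one heis_mul.
Proof. by move=> x; rewrite -[x]reprK heis_mul_pi cats0. Qed.

Lemma heis_mulV : left_inverse heis_one heis_inv heis_mul.
Proof.
move=> x; rewrite heis_invE -{2}[x]reprK heis_mul_pi.
exact/heis_piP/heis_inv_cat.
Qed.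

Lemma heis_mulrV : right_inverse heis_one heis_inv heis_mul.
Proof.
move=> x; rewrite heis_invE -{1}[x]reprK heis_mul_pi.
exact/heis_piP/heis_cat_inv.
Qed.

HB.instance Definition _ :=
  isGroup.Build heis heis_mulA heis_mul1 heis_mulr1 heis_mulV heis_mulrV.

Definition heis_a : heis := \pi_heis [:: letter_a].
Definition heis_b : heis := \pi_heis [:: letter_b].

Definition heis_gens : seq heis := [:: heis_a; heis_b; heis_a^-1; heis_b^-1].

Definition heis_expressible (x : heis) (n : nat) : bool :=
  `[< exists s : seq heis,
      [/\ {subset s <= heis_gens}, size s = n & \prod_(g <- s) g = x] >].

Lemma heis_inv_letter (l : letter) :
  (\pi_heis [:: l])^-1 = \pi_heis [:: letter_inv l].
Proof.
rewrite -[LHS]mulg1.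
have <- : \pi_heis [:: l] * \pi_heis [:: letter_inv l] = 1.
  by rewrite [LHS]heis_mul_pi; apply/heis_piP/heis_cancel.
by rewrite mulKg.
Qed.

Lemma heis_expressible_ex (x : heis) : exists n, heis_expressible x n.
Proof.
rewrite -[x]reprK; elim: (repr x) => [|l u [n /asboolP[s [sS _ su]]]].
  by exists 0; apply/asboolP; exists [::]; rewrite big_nil; split.
exists (size s).+1; apply/asboolP; exists (\pi_heis [:: l] :: s); split => //.
  move=> g; rewrite inE => /predU1P[->|/sS//].
  rewrite /heis_gens !heis_inv_letter !inE.
  by case: l => [[] []]; rewrite eqxx ?orbT.
by rewrite big_cons su [LHS]heis_mul_pi.
Qed.

Definition word_length (x : heis) : nat := ex_minn (heis_expressible_ex x).

Definition dW (x y : heis) : nat := word_length (x^-1 * y).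

Definition heis_ball (R : realType) (r : R) : set heis :=
  [set x | ((dW 1%g x)%:R <= r)%R].

(* Real L_2, as L_2 of the line: a separable, infinite-dimensional Hilbert
   space of almost everywhere classes. *)
Definition L2 (R : realType) : Type :=
  LspaceType2 (@lebesgue_measure R).

Definition L2_dist (R : realType) (f g : L2 R) : \bar R :=
  'N[@lebesgue_measure R]_2%:E [EFin \o ((f : R -> R) \- (g : R -> R))%R]%E.

(* An extended real, so that the infimum over the empty set is +oo. *)
Definition L2_distortion (R : realType) (T : Type) (d : T -> T -> R)
    (B : set T) : \bar R :=
  ereal_inf [set D%:E | D in [set D : R | (1 <= D)%R /\
    exists f : {x : T | B x} -> L2 R, forall x y : {x : T | B x},
      ((d (sval x) (sval y))%:E <= L2_dist (f x) (f y))%E /\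
      (L2_dist (f x) (f y) <= (D * d (sval x) (sval y))%:E)%E]].

Definition heis_distortion (R : realType) (r : R) : \bar R :=
  L2_distortion (fun x y => (dW x y)%:R%R) (heis_ball r).

(* Main.v *)
Require Import Defs.
From HB Require Import structures.
From mathcomp Require Import all_boot all_order all_algebra.
From mathcomp Require Import all_fingroup generic_quotient.
From mathcomp Require Import all_classical all_reals all_analysis.
From mathcomp Require Import measurable_realfun.
From mathcomp Require Import ring lra zify.

(** Write d for the word metric and c = a b a^-1 b^-1.  The centre is
distorted: c^k has length of order sqrt k, because c^(qm) is the commutator of
a^q and b^m and because a word of length n encloses an area at most n^2.  Hence
balls of radius n have order n^4 elements and the metric is doubling
([wball_doubling]).

Upper bound.  At the scale n = 2^k send x to the bump function max(0, n - d(x,.))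
divided by the square root of the volume of a ball of radius n.  This map into
l_2 is Lipschitz at every scale ([bump_lip]) and, by doubling, moves points at
distance about n by about n ([bump_sep]).  The orthogonal sum over the scales
below 2r never loses a constant fraction of the distance, while its squared
Lipschitz constant is the number of scales, which is of order log r.

Lower bound.  Let T be an orthogonal representation of a group in which
a b = c b a with c central, and let A, B, C be the images of a, b, c.  The
truncated Hilbert transform P, which is the sum of (C^j - C^-j)/j over
1 <= j <= M, is skew-adjoint, commutes with everything and has norm at most 5
whatever M is ([hilbert_bound]).  With w = BAu, centrality turns
<(C - 1)u, Pu> into <(C - 1)w, Pw>, and (C - 1)w = [A - 1, B - 1]u.  Moving
one of the two differences onto Pw bounds the pairing by a constant times
|Au - u|^2 + |Bu - u|^2.  On the other hand summation by parts shows that the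
pairing controls the sum of |C^k u - u|^2 / k^2.  This is
[vertical_horizontal]: the vertical variation of u, summed over all scales, is
bounded by the horizontal variation at scale one.

It is applied to right translations of finitely supported functions on the
group.  Given an embedding f of the ball of radius 32m, a value of f is a real
function on the line; at each point t of the line, f(.)(t) minus its value at
the identity is cut off outside the ball, and the resulting inequality between
squares is integrated over t ([L2_transfer]).  For f of distortion D the
horizontal side is of order D^2 m^2 vol(32m), and since d(x, x c^k)^2 >= k the
vertical side is at least of order m^2 vol(8m) times the harmonic sum up to
m^2.  Doubling cancels the volumes and leaves log m = O(D^2). *)

Set Implicit Arguments.
Unset Strict Implicit.
Unset Printing Implicit Defensive.

Import Order.TTheory GRing.Theory Num.Theory.
Import numFieldNormedType.Exports.

Local Open Scope classical_set_scope.
Local Open Scope ring_scope.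

(** * Hilbert's inequality for truncated kernels *)

Section Harmonic.
Context {R : realFieldType}.
Implicit Types (M d i j k : nat) (F : nat -> nat -> R).

Definition harm n : R := \sum_(1 <= i < n.+1) i%:R^-1.

Lemma harmS n : harm n.+1 = harm n + n.+1%:R^-1.
Proof. by rewrite /harm big_nat_recr. Qed.

Lemma harm_sub (m n : nat) : (m <= n)%N ->
  harm n - harm m = \sum_(m.+1 <= i < n.+1) i%:R^-1.
Proof.
by move=> mn; rewrite /harm (big_cat_nat _ (n := m.+1))//= addrAC subrr add0r.
Qed.

Lemma sum_triangle_diff F M :
  \sum_(1 <= i < M.+1) \sum_(1 <= j < i) F i j =
  \sum_(1 <= d < M.+1) \sum_(1 <= j < (M - d).+1) F (j + d)%N j.
Proof.
elim: M => [|M IH]; first by rewrite !big_nil.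
rewrite big_nat_recr//= IH [RHS]big_nat_recr//= subnn [X in _ = _ + X]big_nil addr0.
rewrite [X in _ + X]big_nat_rev/= -big_split/=; apply: eq_big_nat => d /andP[d0 dM].
rewrite subSn// [RHS]big_nat_recr//= add1n subSS.
by rewrite -subSn//; congr (_ + F _ _); rewrite subnK// ltnW.
Qed.

Lemma sum_triangle_sum F M :
  \sum_(1 <= i < M.+1) \sum_(1 <= j < (M - i).+1) F i j =
  \sum_(1 <= d < M.+1) \sum_(1 <= j < d) F (d - j)%N j.
Proof.
rewrite (sum_triangle_diff (fun i j => F (i - j)%N j)).
by apply: eq_big_nat => i _; apply: eq_bigr => j _; rewrite addKn.
Qed.

Lemma sum_square_sym F M : (forall i j, F i j = F j i) ->
  \sum_(1 <= i < M.+1) \sum_(1 <= j < M.+1) F i j =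
  \sum_(1 <= i < M.+1) F i i + 2 * \sum_(1 <= i < M.+1) \sum_(1 <= j < i) F i j.
Proof.
move=> Fsym; elim: M => [|M IH]; first by rewrite !big_nil mulr0 addr0.
rewrite big_nat_recr//= (eq_bigr (fun i => \sum_(1 <= j < M.+1) F i j + F i M.+1)); last first.
  by move=> i _; rewrite big_nat_recr.
rewrite big_split/= IH [X in _ = X + _]big_nat_recr//= [X in _ = _ + 2 * X]big_nat_recr//=.
rewrite [X in _ + _ + X]big_nat_recr//=.
have -> : \sum_(1 <= i < M.+1) F i M.+1 = \sum_(1 <= i < M.+1) F M.+1 i.
  by apply: eq_bigr => i _; exact: Fsym.
ring.
Qed.

Lemma sum_inv_sqr M : \sum_(1 <= i < M.+1) (i%:R ^+ 2)^-1 <= 2 :> R.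
Proof.
case: M => [|M]; first by rewrite big_nil.
suff: \sum_(1 <= i < M.+2) (i%:R ^+ 2)^-1 <= 2 - M.+1%:R^-1 :> R.
  by move/le_trans; apply; rewrite gerBl invr_ge0.
elim: M => [|M IH]; first by rewrite big_nat1 expr1n invr1; lra.
rewrite big_nat_recr//=; apply: le_trans (lerD IH (lexx _)) _.
have x0 : 0 < M.+1%:R :> R by rewrite ltr0n.
rewrite -[M.+2%:R]natr1; set x : R := M.+1%:R in x0 *.
rewrite -subr_ge0 (_ : _ - _ = (x * (x + 1) ^+ 2)^-1).
  by rewrite invr_ge0 mulr_ge0 ?sqr_ge0 ?ltW.
by field; apply/andP; split; lra.
Qed.

(** Since 1/(ij) = (1/i + 1/j)/(i + j) with i + j > M, and since for each i there
are exactly i values of j in the corner, each of the two halves contributes at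
most 1. *)
Lemma sum_far_corner M :
  \sum_(1 <= i < M.+1) \sum_((M - i).+1 <= j < M.+1) (i%:R * j%:R)^-1 <= 2 :> R.
Proof.
case: M => [|M]; first by rewrite big_nil.
set N := M.+1.
have N0 : 0 < N%:R :> R by rewrite ltr0n.
have condE (G : nat -> nat -> R) : \sum_(1 <= i < N.+1) \sum_((N - i).+1 <= j < N.+1) G i j
    = \sum_(1 <= i < N.+1) \sum_(1 <= j < N.+1 | (N < i + j)%N) G i j.
  apply: eq_big_nat => i /andP[i0 iN].
  rewrite (big_nat_widenl _ 1)//=; apply: eq_bigl => j.
  by rewrite -[RHS]ltn_subLR// ?andbT.
have rowE : \sum_(1 <= i < N.+1) \sum_((N - i).+1 <= j < N.+1) i%:R^-1 = N%:R :> R.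
  rewrite [RHS](_ : _ = \sum_(1 <= i < N.+1) 1); last by rewrite sumr_const_nat subSS subn0.
  apply: eq_big_nat => i /andP[i0 iN].
  rewrite sumr_const_nat subSS subKn// -[_ *+ _]mulr_natr mulVf// pnatr_eq0.
  by case: i i0 {iN}.
apply: (@le_trans _ _ (\sum_(1 <= i < N.+1) \sum_((N - i).+1 <= j < N.+1)
    N%:R^-1 * (i%:R^-1 + j%:R^-1))).
  apply: ler_sum_nat => i /andP[i0 iN]; apply: ler_sum_nat => j /andP[j0 jN].
  have {}i0 : 0 < i%:R :> R by rewrite ltr0n.
  have {}jN : N%:R <= i%:R + j%:R :> R.
    by rewrite -natrD ler_nat ltnW// -ltn_subLR.
  have {}j0 : 0 < j%:R :> R by rewrite ltr0n (leq_trans _ j0).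
  rewrite ler_pdivlMl//.
  rewrite (_ : i%:R^-1 + j%:R^-1 = (i%:R + j%:R) * (i%:R * j%:R)^-1); last first.
    by field; rewrite !lt0r_neq0.
  by rewrite ler_wpM2r// invr_ge0 mulr_ge0 ?ltW.
under eq_bigr do rewrite -mulr_sumr big_split/=.
rewrite -mulr_sumr big_split/= rowE condE (exchange_big_dep xpredT)//=.
rewrite ler_pdivrMl//.
suff -> : \sum_(1 <= j < N.+1) \sum_(1 <= i < N.+1 | (N < i + j)%N) j%:R^-1 = N%:R :> R.
  by rewrite mulrC mulr_natl mulr2n.
rewrite -rowE condE; apply: eq_bigr => i _; apply: eq_bigl => j.
by rewrite addnC.
Qed.

(** Partial fractions.  The two logarithmically large sums cancel, leaving a
harmonic tail whose weighted sum over d is the far corner again; this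
cancellation is why Hilbert's kernel is bounded although it is not summable. *)
Lemma hilbert_coef M d : (1 <= d <= M)%N ->
  2 * \sum_(1 <= j < (M - d).+1) ((j + d)%:R * j%:R)^-1
    - \sum_(1 <= j < d) ((d - j)%:R * j%:R)^-1
  = 2 / d%:R * (d%:R^-1 - (harm M - harm (M - d))) :> R.
Proof.
case/andP => d0 dM.
have dR : d%:R != 0 :> R by rewrite pnatr_eq0 -lt0n.
have -> : \sum_(1 <= j < (M - d).+1) ((j + d)%:R * j%:R)^-1
    = d%:R^-1 * (harm (M - d) - (harm M - harm d)) :> R.
  have -> : harm M - harm d = \sum_(1 <= j < (M - d).+1) (j + d)%:R^-1.
    by rewrite harm_sub// -add1n big_addn subSn.
  rewrite /harm -sumrB mulr_sumr.
  apply: eq_big_nat => j /andP[j0 _].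
  rewrite natrD; field; rewrite dR -natrD !pnatr_eq0 -!lt0n j0/=.
  by rewrite addn_gt0 j0.
have -> : \sum_(1 <= j < d) ((d - j)%:R * j%:R)^-1 = d%:R^-1 * (2 * harm d.-1) :> R.
  have hE : harm d.-1 = \sum_(1 <= j < d) (d - j)%:R^-1.
    rewrite /harm prednK// big_nat_rev/=.
    by apply: eq_bigr => j _; rewrite add1n subSS.
  rewrite mulrDl mul1r {1}hE /harm prednK// -big_split mulr_sumr/=.
  apply: eq_big_nat => j /andP[j0 jd].
  rewrite natrB 1?ltnW//; field; rewrite dR -natrB 1?ltnW// !pnatr_eq0 -!lt0n j0/=.
  by rewrite andbT subn_gt0.
have -> : harm d = harm d.-1 + d%:R^-1 by rewrite -{1}(prednK d0) harmS prednK.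
by field.
Qed.

(** Hilbert's inequality with a constant independent of M.  When rho is the
autocorrelation of a vector v under the powers of an isometry, the left side is
half the squared norm of the truncated Hilbert transform of v; terms are grouped
by the value of the argument of rho. *)
Lemma hilbert_sum (rho : nat -> R) M : (forall k, `|rho k| <= rho 0%N) ->
  \sum_(1 <= i < M.+1) \sum_(1 <= j < M.+1)
    (rho (i - j + (j - i))%N - rho (i + j)%N) / (i%:R * j%:R) <= 12 * rho 0%N.
Proof.
move=> rhoP; set r0 := rho 0%N in rhoP *.
have r0_ge0 : 0 <= r0 by apply: le_trans (rhoP 0%N).
under eq_bigr do (under eq_bigr do rewrite mulrBl; rewrite sumrB).
rewrite sumrB sum_square_sym; last first.
  by move=> i j; rewrite addnC [j%:R * _]mulrC.
rewrite (sum_triangle_diff (fun i j => rho (i - j + (j - i))%N / (i%:R * j%:R))).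
have -> : \sum_(1 <= i < M.+1) \sum_(1 <= j < M.+1) rho (i + j)%N / (i%:R * j%:R) =
  \sum_(1 <= i < M.+1) \sum_(1 <= j < (M - i).+1) rho (i + j)%N / (i%:R * j%:R) +
  \sum_(1 <= i < M.+1) \sum_((M - i).+1 <= j < M.+1) rho (i + j)%N / (i%:R * j%:R).
  rewrite -big_split/=; apply: eq_big_nat => i _.
  by rewrite [LHS](big_cat_nat _ (n := (M - i).+1))//= ltnS leq_subr.
rewrite (sum_triangle_sum (fun i j => rho (i + j)%N / (i%:R * j%:R))).
(* the diagonal *)
have h1 : \sum_(1 <= i < M.+1) rho (i - i + (i - i))%N / (i%:R * i%:R) <= 2 * r0.
  apply: le_trans (ler_wpM2r r0_ge0 (sum_inv_sqr M)).
  rewrite mulr_suml; apply: ler_sum_nat => i _.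
  by rewrite subnn mulrC expr2.
(* the pairs with i + j > M, where the other sum has no counterpart *)
have h2 : - (2 * r0) <= \sum_(1 <= i < M.+1) \sum_((M - i).+1 <= j < M.+1)
     rho (i + j)%N / (i%:R * j%:R).
  rewrite lerNl; apply: le_trans (ler_wpM2r r0_ge0 (sum_far_corner M)).
  rewrite -sumrN mulr_suml; apply: ler_sum_nat => i _.
  rewrite -sumrN mulr_suml; apply: ler_sum_nat => j _.
  rewrite -mulNr mulrC ler_wpM2l ?invr_ge0 ?mulr_ge0//.
  by apply: le_trans (rhoP (i + j)%N); rewrite -normrN ler_norm.
(* the arguments 1 <= d <= M of rho, where both sums contribute *)
have h3 : 2 * (\sum_(1 <= d < M.+1) \sum_(1 <= j < (M - d).+1)
      rho (j + d - j + (j - (j + d)))%N / ((j + d)%:R * j%:R)) -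
    \sum_(1 <= d < M.+1) \sum_(1 <= j < d) rho (d - j + j)%N / ((d - j)%:R * j%:R)
    <= 8 * r0.
  have -> : 8 * r0 = 2 * (2 * r0) + 2 * (2 * r0) by ring.
  apply: le_trans (lerD (ler_wpM2l _ (ler_wpM2r r0_ge0 (sum_inv_sqr M)))
                        (ler_wpM2l _ (ler_wpM2r r0_ge0 (sum_far_corner M)))) => //.
  rewrite mulr_sumr -sumrB !mulr_suml !mulr_sumr -big_split/=.
  apply: ler_sum_nat => d /andP[d0]; rewrite ltnS => dM.
  have -> : 2 * (\sum_(1 <= j < (M - d).+1) rho (j + d - j + (j - (j + d)))%N /
               ((j + d)%:R * j%:R)) -
    \sum_(1 <= j < d) rho (d - j + j)%N / ((d - j)%:R * j%:R)
    = rho d * (2 * \sum_(1 <= j < (M - d).+1) ((j + d)%:R * j%:R)^-1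
    - \sum_(1 <= j < d) ((d - j)%:R * j%:R)^-1).
    rewrite mulrBr mulrCA ![rho d * _]mulr_sumr; congr (2 * _ - _).
      by apply: eq_bigr => j _; rewrite addKn subnDA subnn sub0n addn0.
    by apply: eq_big_nat => j /andP[_ /ltnW jd]; rewrite subnK.
  rewrite hilbert_coef ?d0// harm_sub ?leq_subr//.
  under eq_bigr do rewrite invfM.
  rewrite -mulr_sumr.
  set S := \sum_(_ <= _ < _) _.
  have S0 : 0 <= S by apply: sumr_ge0 => j _; rewrite invr_ge0.
  have e0 : 0 <= d%:R^-1 :> R by rewrite invr_ge0.
  rewrite -exprVn; set e := d%:R^-1 in e0 *.
  have := rhoP d; rewrite ler_norml => /andP[r1 r2].
  have : 0 <= e * e * (r0 - rho d) by rewrite !mulr_ge0// subr_ge0.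
  have : 0 <= e * S * (r0 + rho d) by rewrite !mulr_ge0// -lerBlDl sub0r.
  by rewrite expr2; move=> *; lra.
set X2 := \sum_(_ <= _ < _) \sum_(_ <= _ < _) _ in h3 *.
set X3 := \sum_(_ <= _ < _) \sum_(_ <= _ < _) _ in h3 *.
set X4 := \sum_(_ <= _ < _) \sum_(_ <= _ < _) _ in h2 *.
lra.
Qed.
End Harmonic.

(** * Orthogonal representations with a central commutator *)

Section OrthogonalRepresentation.
Context {R : rcfType} {E : lmodType R} (ip : E -> E -> R).
Context (ipDl : forall u v w, ip (u + v) w = ip u w + ip v w).
Context (ipZl : forall a u w, ip (a *: u) w = a * ip u w).
Context (ipC : forall u v, ip u v = ip v u).
Context (ip_ge0 : forall u, 0 <= ip u u).

Let ipDr u v w : ip w (u + v) = ip w u + ip w v.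
Proof. by rewrite ![ip w _]ipC ipDl. Qed.
Let ipZr a u w : ip w (a *: u) = a * ip w u.
Proof. by rewrite ![ip w _]ipC ipZl. Qed.
Let ipNl u w : ip (- u) w = - ip u w.
Proof. by rewrite -scaleN1r ipZl mulN1r. Qed.
Let ipNr u w : ip w (- u) = - ip w u.
Proof. by rewrite ![ip w _]ipC ipNl. Qed.
Let ip0l w : ip 0 w = 0.
Proof. by rewrite -(scale0r 0) ipZl mul0r. Qed.
Let ip_suml m n (F : nat -> E) w :
  ip (\sum_(m <= i < n) F i) w = \sum_(m <= i < n) ip (F i) w.
Proof. by apply: (big_morph (ip^~ w) _ (ip0l w)) => u v; exact: ipDl. Qed.
Let ip_sumr m n (F : nat -> E) w :
  ip w (\sum_(m <= i < n) F i) = \sum_(m <= i < n) ip w (F i).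
Proof. by rewrite ipC ip_suml; apply: eq_bigr => i _; exact: ipC. Qed.

Lemma cauchy_schwarz_sqr u v : ip u v ^+ 2 <= ip u u * ip v v.
Proof.
(* a nonnegative polynomial in t of degree 2, or affine when ip v v = 0;
   either way its coefficients are constrained *)
have Hq t : 0 <= ip u u - 2 * t * ip u v + t ^+ 2 * ip v v.
  suff <- : ip (u - t *: v) (u - t *: v) = ip u u - 2 * t * ip u v + t ^+ 2 * ip v v by [].
  rewrite ipDl !ipDr !ipNl !ipNr !ipZl !ipZr [ip v u]ipC; ring.
have [v0|v0] := eqVneq (ip v v) 0.
  rewrite v0 mulr0.
  have := Hq ((1 + ip u u) / ip u v); rewrite v0 mulr0 addr0.
  have [->|uv0] := eqVneq (ip u v) 0; first by rewrite expr0n.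
  rewrite -mulrA divfK//; have := ip_ge0 u; lra.
have {}v0 : 0 < ip v v by rewrite lt0r v0 ip_ge0.
have := mulr_ge0 (ltW v0) (Hq (ip u v / ip v v)).
rewrite (_ : ip v v * _ = ip u u * ip v v - ip u v ^+ 2) ?subr_ge0//.
by field; rewrite gt_eqF.
Qed.

Definition norm_ip u := Num.sqrt (ip u u).

Let nrm_ge0 u : 0 <= norm_ip u. Proof. exact: sqrtr_ge0. Qed.
Let nrm_sqr u : norm_ip u ^+ 2 = ip u u. Proof. exact/sqr_sqrtr. Qed.

Lemma cauchy_schwarz u v : `|ip u v| <= norm_ip u * norm_ip v.
Proof.
by rewrite -sqrtrM// -sqrtr_sqr; apply: ler_wsqrtr; exact: cauchy_schwarz_sqr.
Qed.

Let nrmD u v : norm_ip (u + v) <= norm_ip u + norm_ip v.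
Proof.
rewrite -(ler_pXn2r (n := 2))// ?nnegrE ?addr_ge0// nrm_sqr sqrrD !nrm_sqr.
rewrite ipDl !ipDr [ip v u]ipC.
have := le_trans (ler_norm _) (cauchy_schwarz u v).
rewrite mulr2n; lra.
Qed.

Let nrmN u : norm_ip (- u) = norm_ip u.
Proof. by rewrite /norm_ip ipNl ipNr opprK. Qed.

Let nrmBC u v : norm_ip (u - v) = norm_ip (v - u).
Proof. by rewrite -nrmN opprB. Qed.

Context {G : groupType} (T : G -> E -> E).
Context (TD : forall g u v, T g (u + v) = T g u + T g v).
Context (TZ : forall g a u, T g (a *: u) = a *: T g u).
Context (T1 : forall u, T 1%g u = u).
Context (TM : forall g h u, T (g * h)%g u = T g (T h u)).
Context (T_iso : forall g u v, ip (T g u) (T g v) = ip u v).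

Let TN g u : T g (- u) = - T g u.
Proof. by rewrite -scaleN1r TZ scaleN1r. Qed.
Let T0 g : T g 0 = 0.
Proof. by rewrite -{1}(scale0r 0) TZ scale0r. Qed.
Let T_sum g m n (F : nat -> E) :
  T g (\sum_(m <= i < n) F i) = \sum_(m <= i < n) T g (F i).
Proof. by apply: (big_morph (T g) _ (T0 g)) => u v; exact: TD. Qed.
Let nrmT g u : norm_ip (T g u) = norm_ip u.
Proof. by rewrite /norm_ip T_iso. Qed.
Let ipT g u v : ip (T g u) v = ip u (T g^-1%g v).
Proof. by rewrite -(T_iso g^-1%g) -TM mulVg T1. Qed.

Definition displacement g u := norm_ip (T g u - u).

Let displacementM g h u : displacement (g * h)%g u <= displacement g u + displacement h u.
Proof.
rewrite /displacement TM (_ : _ - u = T g (T h u - u) + (T g u - u)).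
  by rewrite addrC; apply: le_trans (nrmD _ _) _; rewrite nrmT addrC.
by rewrite TD TN addrA subrK.
Qed.

Let displacementV g u : displacement g^-1%g u = displacement g u.
Proof.
rewrite /displacement -(nrmT g) TD TN -TM mulgV T1; exact: nrmBC.
Qed.

Context (c : G).

(** Convolution with the truncated odd kernel 1/j along the powers of c. *)
Definition hilbert M v :=
  \sum_(1 <= j < M.+1) j%:R^-1 *: (T (c ^+ j)%g v - T (c ^- j)%g v).

Definition autocorr v k := ip (T (c ^+ k)%g v) v.

Let ip_pow v i j :
  ip (T (c ^+ i)%g v) (T (c ^+ j)%g v) = autocorr v (i - j + (j - i)).
Proof.
wlog ij : i j / (i <= j)%N.
  by move=> H; case/orP: (leq_total i j) => /H//; rewrite ipC addnC.
move/eqP: (ij) => ->; rewrite add0n -{1}(subnKC ij) expgD TM T_iso ipC.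
by [].
Qed.

Let ip_powN v i j :
  ip (T (c ^+ i)%g v) (T (c ^- j)%g v) = autocorr v (i + j).
Proof. by rewrite ipC ipT invgK -TM -expgD ipC addnC. Qed.

Let ip_powNN v i j :
  ip (T (c ^- i)%g v) (T (c ^- j)%g v) = autocorr v (i - j + (j - i)).
Proof.
rewrite ipT invgK -TM.
have -> : (c ^+ i * c ^- j = c ^- j * c ^+ i)%g.
  by apply/commuteV/commuteX/commute_sym/commuteX.
by rewrite TM -ipT ip_pow addnC.
Qed.

Lemma autocorr_bound v k : `|autocorr v k| <= autocorr v 0.
Proof.
rewrite {2}/autocorr expg0 T1; apply: le_trans (cauchy_schwarz _ _) _.
by rewrite nrmT -expr2 nrm_sqr.
Qed.

(** The inner products of C^i v - C^-i v with C^j v - C^-j v depend only on |i - j|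
and i + j, so that [hilbert_sum] applies to the autocorrelation of v. *)
Lemma hilbert_bound M v : norm_ip (hilbert M v) <= 5 * norm_ip v.
Proof.
rewrite -(ler_pXn2r (n := 2))// ?nnegrE ?mulr_ge0//.
rewrite exprMn !nrm_sqr; apply: (@le_trans _ _ (2 * (12 * autocorr v 0))); last first.
  by rewrite /autocorr expg0 T1 mulrA ler_wpM2r//; lra.
have := @hilbert_sum R (autocorr v) M (autocorr_bound v).
move/(ler_wpM2l (ler0n R 2)); apply: le_trans.
rewrite /hilbert ip_suml mulr_sumr; apply: ler_sum_nat => i _.
rewrite ip_sumr mulr_sumr; apply: ler_sum_nat => j _.
rewrite ipZl ipZr ipDl !ipDr !ipNl !ipNr ip_pow ip_powN ip_powNN.
rewrite [ip (T (c ^- i)%g v) _]ipC ip_powN [(j + i)%N]addnC invfM.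
by rewrite le_eqVlt; apply/orP; left; apply/eqP; ring.
Qed.

Lemma hilbert_skew M v : ip v (hilbert M v) = 0.
Proof.
rewrite /hilbert ip_sumr big1// => j _.
have := ip_pow v 0 j; have := ip_powN v 0 j.
by rewrite expg0 T1 ipZr ipDr ipNr => -> ->; rewrite add0n sub0n add0n subn0 subrr mulr0.
Qed.

(** The weights 1/j turn first differences of de into the positive weights
1/(k+1) - 1/(k+3), which are at least 2/(k+2)^2.  For the squared displacements
of a vector by the powers of c only the boundary term in de 1 is negative, and it
is bounded by the displacements by a and b because c is their commutator. *)
Lemma sum_by_parts_inv M (de : nat -> R) : de 0%N = 0 ->
  \sum_(1 <= j < M.+3) j%:R^-1 * (de j.+1 - de j.-1) =
  \sum_(0 <= k < M) de k.+2 * (k.+1%:R^-1 - k.+3%:R^-1)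
  + de M.+2 / M.+1%:R + de M.+3 / M.+2%:R - de 1%N / 2.
Proof.
move=> d0; elim: M => [|M IH].
  by rewrite big_nil 2?big_nat_recr// big_nil/= d0 !invr1; field.
by rewrite big_nat_recr//= IH big_nat_recr//=; ring.
Qed.

Context (c_central : forall g, (c * g = g * c)%g).

Let cX_central j g : (c ^+ j * g = g * c ^+ j)%g.
Proof. by apply/commute_sym/commuteX/commute_sym/c_central. Qed.

Let cXN_central j g : (c ^- j * g = g * c ^- j)%g.
Proof. by apply/commute_sym/commuteV/commute_sym/cX_central. Qed.

Lemma hilbert_comm M g v : T g (hilbert M v) = hilbert M (T g v).
Proof.
rewrite /hilbert T_sum; apply: eq_bigr => j _.
by rewrite TZ TD TN -!TM cX_central cXN_central.
Qed.

Lemma hilbertB M v w : hilbert M v - hilbert M w = hilbert M (v - w).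
Proof.
rewrite /hilbert -sumrB; apply: eq_bigr => j _.
by rewrite -scalerBr !TD !TN !opprB addrACA [- _ - _]addrC [in RHS]addrACA.
Qed.

Context (a b : G).
Context (abc : (a * b = c * b * a)%g).

(** The pairing of C u with H u, where H is the Hilbert transform, is evaluated
twice: algebraically as a commutator (Q1), and as a weighted sum of the squared
displacements of u by the powers of c (Q2). *)
Theorem vertical_horizontal M u :
  \sum_(0 <= k < M) ip (T (c ^+ k.+2)%g u - u) (T (c ^+ k.+2)%g u - u) / k.+2%:R ^+ 2
  <= 27 * (ip (T a u - u) (T a u - u) + ip (T b u - u) (T b u - u)).
Proof.
rewrite -!nrm_sqr -!/(displacement _ _); set al := displacement a u; set be := displacement b u.
have al0 : 0 <= al by exact: nrm_ge0.
have be0 : 0 <= be by exact: nrm_ge0.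
pose H := hilbert M.+2.
pose w := T (b * a)%g u.
have swap g z x : ip (T g x - x) (H z) <= 5 * (norm_ip x * displacement g z).
  have -> : ip (T g x - x) (H z) = ip x (H (T g^-1%g z - z)).
    by rewrite /H -hilbertB -hilbert_comm ipDl ipNl ipT ipDr ipNr.
  apply: le_trans (ler_norm _) _; apply: le_trans (cauchy_schwarz _ _) _.
  rewrite mulrCA ler_wpM2l//; apply: le_trans (hilbert_bound _ _) _.
  by rewrite -/(displacement _ _) displacementV.
have dw g : displacement g w <= displacement g u + 2 * displacement b u + 2 * displacement a u.
  have -> : displacement g w = norm_ip ((T (g * (b * a))%g u - u) - (T (b * a)%g u - u)).
    by rewrite /displacement /w -TM opprB addrA subrK.
  apply: le_trans (nrmD _ _) _; rewrite nrmN -!/(displacement _ _).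
  have := displacementM g (b * a)%g u; have := displacementM b a u; lra.
(* u may be replaced by w because T (b * a) is isometric and commutes with C
   and H; then C w - w is the commutator of A - 1 and B - 1 at u *)
have Q1 : ip (T c u) (H u) <= 25 * (al ^+ 2 + be ^+ 2).
  have -> : ip (T c u) (H u) = ip (T c w - w) (H w).
    rewrite ipDl ipNl hilbert_skew subr0 /w /H -hilbert_comm -TM c_central TM T_iso.
    by [].
  have -> : T c w - w = (T a (T b u - u) - (T b u - u)) - (T b (T a u - u) - (T a u - u)).
    rewrite /w -TM mulgA -abc !TM !TD !TN -!TM.
    have sub2 p x y z : p - x - (y - z) = p - (x + y - z) :> E.
      by rewrite -addrA -opprD addrA.
    rewrite (sub2 (T (b * a)%g u)) [in RHS](sub2 (T (a * b)%g u)) [T b u + _]addrC.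
    by move: (T a u + T b u - u) => s; rewrite opprB addrA subrK.
  rewrite ipDl ipNl -ipNl.
  have -> : ip (- (T b (T a u - u) - (T a u - u))) (H w) =
      ip (T b (- (T a u - u)) - (- (T a u - u))) (H w).
    by rewrite TN opprD.
  have := swap a w (T b u - u); have := swap b w (- (T a u - u)).
  rewrite nrmN -!/(displacement _ _) -/al -/be.
  have := ler_wpM2l be0 (dw a); have := ler_wpM2l al0 (dw b).
  rewrite -/al -/be.
  have : 0 <= (al - be) ^+ 2 by rewrite sqr_ge0.
  by lra.
pose de k := autocorr u 0 - autocorr u k.
have deE k : de k = displacement (c ^+ k)%g u ^+ 2 / 2.
  rewrite /displacement nrm_sqr ipDl !ipDr !ipNl !ipNr T_iso [ip u (T _ _)]ipC.
  by rewrite /de /autocorr expg0 T1; field.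
have Q2 : ip (T c u) (H u) = \sum_(1 <= j < M.+3) j%:R^-1 * (de j.+1 - de j.-1).
  rewrite /H /hilbert ip_sumr; apply: eq_big_nat => j /andP[j0 _].
  have := ip_pow u 1 j; have := ip_powN u 1 j; rewrite expg1 ipZr ipDr ipNr => -> ->.
  congr (_ * _); rewrite /de add1n subn1.
  have -> : (1 - j + j.-1 = j.-1)%N by case: j j0.
  ring.
have dc : displacement c u <= 2 * (al + be).
  have -> : c = (a * b * a^-1 * b^-1)%g by rewrite abc !mulgK.
  have := displacementM (a * b * a^-1)%g b^-1%g u; have := displacementM (a * b)%g a^-1%g u.
  by have := displacementM a b u; rewrite !displacementV -/al -/be; lra.
have dc2 : displacement c u ^+ 2 <= 8 * (al ^+ 2 + be ^+ 2).
  have : displacement c u ^+ 2 <= (2 * (al + be)) ^+ 2.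
    by rewrite ler_pXn2r// nnegrE ?nrm_ge0// mulr_ge0// addr_ge0.
  by have : 0 <= (al - be) ^+ 2 by [rewrite sqr_ge0]; lra.
have de0 : de 0%N = 0 by rewrite /de subrr.
have de_ge0 k : 0 <= de k by rewrite deE mulr_ge0// ?sqr_ge0// invr_ge0.
move: Q1; rewrite Q2 (sum_by_parts_inv _ de0) => Q1.
apply: (@le_trans _ _ (\sum_(0 <= k < M) de k.+2 * (k.+1%:R^-1 - k.+3%:R^-1))).
  apply: ler_sum_nat => k _; rewrite deE -nrm_sqr -/(displacement _ _).
  rewrite -[X in _ <= X]mulrA ler_wpM2l ?sqr_ge0//.
  rewrite -[k.+3%:R]natr1 -[k.+2%:R]natr1.
  set x : R := k.+1%:R.
  have x0 : 0 < x by rewrite ltr0n.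
  rewrite -subr_ge0 (_ : _ - _ = (x * (x + 1 + 1) * (x + 1) ^+ 2)^-1).
    by rewrite invr_ge0 !mulr_ge0 ?sqr_ge0//; lra.
  by field; rewrite !lt0r_neq0//; lra.
have p1 : 0 <= de M.+2 / M.+1%:R by rewrite mulr_ge0// invr_ge0.
have p2 : 0 <= de M.+3 / M.+2%:R by rewrite mulr_ge0// invr_ge0.
move: (deE 1%N) Q1 p1 p2 dc2; rewrite expg1.
move: (de 1%N) (de M.+2 / _) (de M.+3 / _) (displacement c u ^+ 2) (al ^+ 2 + be ^+ 2).
by move: (\sum_(0 <= k < M) _) => S d1 y1 y2 t X *; lra.
Qed.

End OrthogonalRepresentation.

(** * The right regular representation *)

Section FinSupp.
Context {R : realType} {G : groupType}.

(** Finite support makes the l_2 product of functions a finite sum; [R^o] is R as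
a module over itself, which is what makes [G -> R^o] a module. *)
Definition finsupp_pred : {pred G -> R^o} :=
  fun f => `[< finite_set (f @^-1` [set~ 0]) >].

Lemma finsupp_submod : submod_closed finsupp_pred.
Proof.
split=> [|a u v /asboolP fu /asboolP fv]; apply/asboolP.
  by rewrite (_ : _ @^-1` _ = set0)//; apply/seteqP; split=> x //=.
apply: (sub_finite_set (B := u @^-1` [set~ 0] `|` v @^-1` [set~ 0])).
  move=> x /= H; apply/not_andP => -[u0 v0]; apply: H.
  by rewrite -[LHS]/(a *: u x + v x) u0 v0 scaler0 addr0.
by rewrite finite_setU.
Qed.

HB.instance Definition _ := GRing.isSubmodClosed.Build R (G -> R^o) finsupp_pred
  finsupp_submod.

Record finsupp := FinSupp { fsval :> G -> R^o ; fsvalP : fsval \in finsupp_pred }.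
HB.instance Definition _ := [isSub for fsval].
HB.instance Definition _ := [Choice of finsupp by <:].
HB.instance Definition _ := [SubChoice_isSubLmodule of finsupp by <:].

Definition fsdot (u v : finsupp) : R := \sum_(x \in [set: G]) u x * v x.

Lemma finsupp_fin (u : finsupp) : finite_set (u @^-1` [set~ 0]).
Proof. by case: u => f /= /asboolP. Qed.

Lemma fsdotE (D : set G) (u v : finsupp) : u @^-1` [set~ 0] `<=` D ->
  fsdot u v = \sum_(x \in D) u x * v x.
Proof.
move=> uD; rewrite /fsdot -(fsbig_widen D)// => x [_ /= Dx].
have [->|/eqP u0] := eqVneq (u x) 0; first exact: mul0r.
by case: Dx; exact: uD.
Qed.

Lemma fsdotDl u v w : fsdot (u + v) w = fsdot u w + fsdot v w.
Proof.
pose D := u @^-1` [set~ 0] `|` v @^-1` [set~ 0].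
have Dfin : finite_set D by rewrite finite_setU; split; exact: finsupp_fin.
rewrite !(@fsdotE D); last 3 first.
- by move=> x; right.
- by move=> x; left.
- move=> x /= H; apply/not_andP => -[u0 v0]; apply: H.
  by rewrite -[LHS]/(u x + v x) u0 v0 addr0.
by rewrite -fsbig_split//; apply: eq_fsbigr => x _; exact: mulrDl.
Qed.

Lemma fsdotZl a u w : fsdot (a *: u) w = a * fsdot u w.
Proof. by rewrite /fsdot mulr_fsumr; apply: eq_fsbigr => x _; rewrite mulrA. Qed.

Lemma fsdotC u v : fsdot u v = fsdot v u.
Proof. by apply: eq_fsbigr => x _; rewrite mulrC. Qed.

Lemma fsdot_ge0 u : 0 <= fsdot u u.
Proof. by apply: fsumr_ge0 => x _; rewrite -expr2 sqr_ge0. Qed.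

Lemma mulg_bij (g : G) : bijective (fun x : G => x * g)%g.
Proof. by exists (fun x => x * g^-1)%g => x; rewrite ?mulgK ?mulgKV ?mulgVK. Qed.

Lemma rtrans_finsupp (g : G) (u : finsupp) :
  (fun x => u (x * g)%g) \in finsupp_pred.
Proof.
apply/asboolP.
apply: (sub_finite_set (B := (fun x => x * g^-1)%g @` (u @^-1` [set~ 0]))).
  by move=> x /= ux; exists (x * g)%g => //; rewrite mulgK.
exact/finite_image/finsupp_fin.
Qed.

Definition rtrans g u := FinSupp (rtrans_finsupp g u).

Lemma rtrans_iso g u v : fsdot (rtrans g u) (rtrans g v) = fsdot u v.
Proof.
by rewrite [RHS]/fsdot (reindex_fsbigT (fun x => x * g)%g _ (mulg_bij g)).
Qed.

(** Right translation of finitely supported functions is an orthogonal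
representation, so that [vertical_horizontal] applies. *)
Theorem vertical_horizontal_fun (a b c : G) (f : G -> R^o) M :
  (forall g, (c * g = g * c)%g) -> (a * b = c * b * a)%g ->
  finite_set (f @^-1` [set~ 0]) ->
  \sum_(0 <= k < M)
     (\sum_(x \in [set: G]) (f (x * c ^+ k.+2)%g - f x) ^+ 2) / k.+2%:R ^+ 2
  <= 27 * (\sum_(x \in [set: G]) (f (x * a)%g - f x) ^+ 2 +
           \sum_(x \in [set: G]) (f (x * b)%g - f x) ^+ 2).
Proof.
move=> cC abc /asboolP fP; pose u := FinSupp fP.
have E g : \sum_(x \in [set: G]) (f (x * g)%g - f x) ^+ 2 =
    fsdot (rtrans g u - u) (rtrans g u - u).
  by apply: eq_fsbigr => x _; rewrite expr2.
under eq_bigr do rewrite E.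
rewrite !E.
apply: (vertical_horizontal fsdotDl fsdotZl fsdotC fsdot_ge0 (T := rtrans)) => //.
- by move=> g v w; apply: val_inj.
- by move=> g k v; apply: val_inj.
- by move=> v; apply: val_inj; apply/funext => x /=; rewrite mulg1.
- by move=> g h v; apply: val_inj; apply/funext => x /=; rewrite mulgA.
- exact: rtrans_iso.
Qed.
End FinSupp.

(** * The word metric of the Heisenberg group *)

Arguments word_length x%_g.
Arguments dW (x y)%_g.

Section WordMetric.
Local Open Scope quotient_scope.
Local Open Scope group_scope.

Lemma word_length_le (s : seq heis) :
  {subset s <= heis_gens} -> (word_length (\prod_(g <- s) g) <= size s)%N.
Proof.
move=> sS; rewrite /word_length; case: ex_minnP => m _; apply.
by apply/asboolP; exists s.
Qed.

Lemma word_length_ex (x : heis) : exists s : seq heis,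
  [/\ {subset s <= heis_gens}, size s = word_length x & \prod_(g <- s) g = x].
Proof. by rewrite /word_length; case: ex_minnP => m /asboolP. Qed.

Lemma word_length1 : word_length 1 = 0%N.
Proof.
by apply/eqP; have := @word_length_le [::]; rewrite big_nil leqn0; apply.
Qed.

Lemma word_lengthM x y : (word_length (x * y) <= word_length x + word_length y)%N.
Proof.
have [s [sS <- {1}<-]] := word_length_ex x.
have [t [tS <- {1}<-]] := word_length_ex y.
rewrite -big_cat -size_cat; apply: word_length_le => g.
by rewrite mem_cat => /orP[/sS|/tS].
Qed.

Lemma gens_inv g : g \in heis_gens -> g^-1 \in heis_gens.
Proof.
by rewrite !inE => /or4P[] /eqP->; rewrite ?invgK eqxx ?orbT.
Qed.

Lemma word_lengthV x : word_length x^-1 = word_length x.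
Proof.
suff H y : (word_length y^-1 <= word_length y)%N.
  by apply/eqP; rewrite eqn_leq H -{1}[x]invgK H.
have [s [sS <- <-]] := word_length_ex y; elim: s sS => [|g s IH] sS.
  by rewrite big_nil invg1 word_length1.
rewrite big_cons invMg/= -addn1; apply: leq_trans (word_lengthM _ _) _.
apply: leq_add; first by apply: IH => h hs; apply: sS; rewrite inE hs orbT.
have := @word_length_le [:: g^-1]; rewrite big_seq1; apply => h.
by rewrite inE => /eqP->; apply/gens_inv/sS; rewrite inE eqxx.
Qed.

Lemma word_length_gen g : g \in heis_gens -> (word_length g <= 1)%N.
Proof.
move=> gS; have := @word_length_le [:: g]; rewrite big_seq1; apply => h.
by rewrite inE => /eqP->.
Qed.

Lemma word_lengthX g n : g \in heis_gens -> (word_length (g ^+ n) <= n)%N.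
Proof.
move=> gS; elim: n => [|n IH]; first by rewrite expg0 word_length1.
rewrite expgS; apply: leq_trans (word_lengthM _ _) _.
by rewrite -add1n leq_add// word_length_gen.
Qed.

Lemma dW_sym x y : dW x y = dW y x.
Proof. by rewrite /dW -word_lengthV invMg invgK. Qed.

Lemma dW_triangle y x z : (dW x z <= dW x y + dW y z)%N.
Proof.
rewrite /dW; have -> : x^-1 * z = (x^-1 * y) * (y^-1 * z) by rewrite -mulgA mulKVg.
exact: word_lengthM.
Qed.

Lemma dW1 x : dW 1 x = word_length x.
Proof. by rewrite /dW invg1 mul1g. Qed.

Lemma dW_mulr x g : dW x (x * g) = word_length g.
Proof. by rewrite /dW mulKg. Qed.

Definition triple : Type := (int * int * int)%type.

(** The product of integer unitriangular 3x3 matrices with entries x, y next to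
the diagonal and z in the corner. *)
Definition tmul (p q : triple) : triple :=
  ((p.1.1 + q.1.1, p.1.2 + q.1.2), p.2 + q.2 + p.1.1 * q.1.2)%R.

Lemma tmulA : associative tmul.
Proof.
move=> [[x y] z] [[x' y'] z'] [[x'' y''] z'']; rewrite /tmul/=.
by congr (_, _, _); ring.
Qed.

Definition letter_coord (l : letter) : triple :=
  match l with
  | (false, s) => (((-1) ^+ s)%R, 0%R, 0%R)
  | (true, s) => (0%R, ((-1) ^+ s)%R, 0%R)
  end.

Definition word_coord (w : word) : triple :=
  foldr (fun l => tmul (letter_coord l)) (0%R, 0%R, 0%R) w.

Lemma tmul0 p : tmul (0%R, 0%R, 0%R) p = p.
Proof. by case: p => [[x y] z]; rewrite /tmul/= !add0r mul0r addr0. Qed.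

Lemma word_coord_cat u v : word_coord (u ++ v) = tmul (word_coord u) (word_coord v).
Proof.
by elim: u => [|l u IH]/=; [rewrite tmul0 | rewrite IH tmulA].
Qed.

(** The coordinates satisfy the defining relations: the commutator has coordinates
(0, 0, 1), which are central for [tmul]. *)
Lemma word_coord_cong u v : heis_cong u v -> word_coord u = word_coord v.
Proof.
elim=> //.
- by move=> u0 v0 w _ -> _ ->.
- by move=> ? ? ? ? _ E _ E'; rewrite !word_coord_cat E E'.
- by case=> [[] []].
- move=> w; rewrite !word_coord_cat.
  have -> : word_coord comm_ab = (0%R, 0%R, 1%R) by [].
  by case: (word_coord w) => [[x y] z]; rewrite /tmul/=; congr (_, _, _); ring.
Qed.

Definition coord (x : heis) : triple := word_coord (repr x).

Lemma coord_pi w : coord (\pi_heis w) = word_coord w.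
Proof. exact/word_coord_cong/heis_cong_repr. Qed.

Lemma heis_piM (u v : word) : \pi_heis u * \pi_heis v = \pi_heis (u ++ v).
Proof. exact: heis_mul_pi. Qed.

Lemma coordM x y : coord (x * y) = tmul (coord x) (coord y).
Proof.
by rewrite -[x]reprK -[y]reprK heis_piM !coord_pi word_coord_cat.
Qed.

Lemma coord1 : coord 1 = (0%R, 0%R, 0%R).
Proof. exact: (coord_pi [::]). Qed.

Lemma coord_a : coord heis_a = (1%R, 0%R, 0%R).
Proof. by rewrite coord_pi. Qed.

Lemma coord_b : coord heis_b = (0%R, 1%R, 0%R).
Proof. by rewrite coord_pi. Qed.

Lemma coord_aV : coord heis_a^-1 = ((-1)%R, 0%R, 0%R).
Proof. by rewrite heis_inv_letter coord_pi. Qed.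

Lemma coord_bV : coord heis_b^-1 = (0%R, (-1)%R, 0%R).
Proof. by rewrite heis_inv_letter coord_pi. Qed.

(** A letter a^+-1 put in front of a word changes the third coordinate by the
second coordinate of the word, hence by at most its length; the quadratic growth
follows. *)
Lemma coord_bound x : let n := word_length x : int in let p := coord x in
  (`|p.1.1| <= n /\ `|p.1.2| <= n /\ `|p.2| <= n * n)%R.
Proof.
have [s [sS <- <-]] := word_length_ex x; elim: s sS => [|g s IH] sS.
  by rewrite big_nil coord1.
have /IH : {subset s <= heis_gens} by move=> h hs; apply: sS; rewrite inE hs orbT.
rewrite big_cons coordM; case: (coord _) => [[i j] k] /= [hi [hj hk]].
have : g \in heis_gens by apply: sS; rewrite inE eqxx.
rewrite !inE /tmul => /or4P[] /eqP->; rewrite ?(coord_a, coord_b, coord_aV, coord_bV)/=;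
 split; [|split| |split| |split | |split]; nia.
Qed.

Definition heis_c : heis := heis_a * heis_b * heis_a^-1 * heis_b^-1.

Lemma heis_cE : heis_c = \pi_heis comm_ab.
Proof.
by rewrite /heis_c !heis_inv_letter !heis_piM.
Qed.

Lemma heis_c_central g : heis_c * g = g * heis_c.
Proof.
rewrite heis_cE -[g]reprK !heis_piM.
exact/heis_piP/heis_central.
Qed.

Lemma heis_ab : heis_a * heis_b = heis_c * heis_b * heis_a.
Proof. by rewrite /heis_c !mulgVK. Qed.

Lemma coord_c : coord heis_c = (0%R, 0%R, 1%R).
Proof. by rewrite heis_cE coord_pi. Qed.

Definition zpow (x : heis) (i : int) : heis :=
  match i with Posz n => x ^+ n | Negz n => x ^- n.+1 end.

Lemma zpowS x i : zpow x (i + 1)%R = x * zpow x i.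
Proof.
case: i => [n|[|n]]; first by rewrite -PoszD addn1 /= expgS.
  by rewrite -[LHS]/1 -[zpow x _]/(x^-1) mulgV.
rewrite [LHS](_ : _ = zpow x (Negz n)); last by congr zpow; lia.
by rewrite /zpow [X in _ = _ * X^-1]expgSr invMg mulVKg.
Qed.

Lemma int_succ_ind (P : int -> Prop) : P 0%R ->
  (forall i, P i <-> P (i + 1)%R) -> forall i, P i.
Proof.
move=> P0 PS; case=> n; first by elim: n => // n /PS; rewrite -PoszD addn1.
elim: n => [|n IH]; first exact: (PS (Negz 0)).2.
apply: (PS (Negz n.+1)).2.
by rewrite (_ : (Negz n.+1 + 1)%R = Negz n)//; lia.
Qed.

(** With the powers of b first, the coordinates of the product are its exponents,
with no correction term. *)
Definition normal_form (p : triple) : heis :=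
  zpow heis_b p.1.2 * zpow heis_a p.1.1 * zpow heis_c p.2.

Lemma zpow_cC i g : zpow heis_c i * g = g * zpow heis_c i.
Proof.
case: i => n /=.
  exact/commute_sym/commuteX/commute_sym/heis_c_central.
exact/commute_sym/commuteV/commuteX/commute_sym/heis_c_central.
Qed.

Lemma zpowD x i j : zpow x (i + j)%R = zpow x i * zpow x j.
Proof.
move: i; apply: int_succ_ind; first by rewrite add0r mul1g.
move=> i; rewrite addrAC !zpowS -mulgA; split=> [->//|].
exact: mulgI.
Qed.

(** The relation a b = c b a, iterated. *)
Lemma a_zpow_b j : heis_a * zpow heis_b j = zpow heis_b j * heis_a * zpow heis_c j.
Proof.
move: j; apply: int_succ_ind; first by rewrite /= mul1g !mulg1.
move=> j; rewrite !zpowS mulgA heis_ab.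
have -> : heis_c * heis_b * heis_a * zpow heis_b j = heis_b * (heis_a * zpow heis_b j) * heis_c.
  by rewrite -heis_c_central !mulgA.
have -> : heis_b * zpow heis_b j * heis_a * (heis_c * zpow heis_c j)
  = heis_b * (zpow heis_b j * heis_a * zpow heis_c j) * heis_c.
  by rewrite heis_c_central !mulgA.
by split=> [->//|/mulIg/mulgI].
Qed.

Lemma normal_form_a p : normal_form (tmul (1%R, 0%R, 0%R) p) = heis_a * normal_form p.
Proof.
case: p => [[i j] k]; rewrite /normal_form /tmul/= !add0r mul1r.
rewrite [(1 + i)%R]addrC zpowS [(k + j)%R]addrC zpowD !mulgA a_zpow_b.
by congr (_ * _); rewrite -!mulgA zpow_cC !mulgA.
Qed.

Lemma normal_form_b p : normal_form (tmul (0%R, 1%R, 0%R) p) = heis_b * normal_form p.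
Proof.
case: p => [[i j] k]; rewrite /normal_form /tmul/= !add0r mul0r addr0.
by rewrite [(1 + j)%R]addrC zpowS !mulgA.
Qed.

(** Multiplying by a or b on the left acts on normal forms as on coordinates; the
inverse letters follow by cancellation.  In particular coordinates separate the
elements of the presented group. *)
Lemma normal_formK x : normal_form (coord x) = x.
Proof.
have [s [sS _ <-]] := word_length_ex x; elim: s sS => [|g s IH] sS.
  by rewrite big_nil coord1 /normal_form/= !mulg1.
rewrite big_cons coordM.
have {}IH : normal_form (coord (\prod_(h <- s) h)) = \prod_(h <- s) h.
  by apply: IH => h hs; apply: sS; rewrite inE hs orbT.
move: (coord _) IH => p <-.
have : g \in heis_gens by apply: sS; rewrite inE eqxx.
have inv_a q : tmul (1%R, 0%R, 0%R) (tmul ((-1)%R, 0%R, 0%R) q) = q.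
  by case: q => [[i j] k]; rewrite /tmul/=; congr (_, _, _); ring.
have inv_b q : tmul (0%R, 1%R, 0%R) (tmul (0%R, (-1)%R, 0%R) q) = q.
  by case: q => [[i j] k]; rewrite /tmul/=; congr (_, _, _); ring.
rewrite !inE => /or4P[] /eqP->; rewrite ?(coord_a, coord_b, coord_aV, coord_bV).
- exact: normal_form_a.
- exact: normal_form_b.
- by apply: (mulgI heis_a); rewrite -normal_form_a inv_a mulKVg.
- by apply: (mulgI heis_b); rewrite -normal_form_b inv_b mulKVg.
Qed.

Lemma coord_inj : injective coord.
Proof. exact: can_inj normal_formK. Qed.

Lemma coord_aX n : coord (heis_a ^+ n) = (Posz n, 0%R, 0%R).
Proof.
elim: n => [|n IH]; first by rewrite expg0 coord1.
by rewrite expgS coordM IH coord_a /tmul/= -PoszD add1n !mulr0.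
Qed.

Lemma coord_bX n : coord (heis_b ^+ n) = (0%R, Posz n, 0%R).
Proof.
elim: n => [|n IH]; first by rewrite expg0 coord1.
by rewrite expgS coordM IH coord_b /tmul/=; congr (_, _, _); lia.
Qed.

Lemma coord_cX n : coord (heis_c ^+ n) = (0%R, 0%R, Posz n).
Proof.
elim: n => [|n IH]; first by rewrite expg0 coord1.
by rewrite expgS coordM IH coord_c /tmul/=; congr (_, _, _); lia.
Qed.

Lemma word_length_c_ge k : (k <= word_length (heis_c ^+ k) ^ 2)%N.
Proof.
have [_ [_]] := coord_bound (heis_c ^+ k); rewrite coord_cX /=.
by rewrite -mulnn; lia.
Qed.

(** The source of the distortion of the centre: c^(qm) has length at most 2(q + m). *)
Lemma heis_cX_mul q m :
  heis_c ^+ (q * m) = heis_a ^- q * heis_b ^- m * heis_a ^+ q * heis_b ^+ m.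
Proof.
apply: (mulgI (heis_b ^+ m * heis_a ^+ q)).
rewrite -!mulgA mulKVg mulKVg.
by apply: coord_inj; rewrite !coordM !coord_aX !coord_bX coord_cX /tmul/=; congr (_, _, _); lia.
Qed.

Lemma gen_a : heis_a \in heis_gens. Proof. by rewrite inE eqxx. Qed.
Lemma gen_b : heis_b \in heis_gens. Proof. by rewrite !inE eqxx orbT. Qed.

Lemma word_length_comm q m :
  (word_length (heis_a ^- q * heis_b ^- m * heis_a ^+ q * heis_b ^+ m) <= 2 * (q + m))%N.
Proof.
apply: (@leq_trans (q + m + q + m)); last by lia.
have wX g n : g \in heis_gens -> (word_length (g ^- n) <= n)%N.
  by rewrite word_lengthV; exact: word_lengthX.
apply: leq_trans (word_lengthM _ _) (leq_add _ (word_lengthX _ gen_b)).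
apply: leq_trans (word_lengthM _ _) (leq_add _ (word_lengthX _ gen_a)).
exact: leq_trans (word_lengthM _ _) (leq_add (wX _ _ gen_a) (wX _ _ gen_b)).
Qed.

(** Euclidean division k = qm + r writes c^k as the product of the commutators of
a^q with b^m and of a with b^r. *)
Lemma word_length_c_le k m : (k <= m ^ 2)%N -> (word_length (heis_c ^+ k) <= 8 * m)%N.
Proof.
case: m => [|m]; first by rewrite leqn0 => /eqP->; rewrite expg0 word_length1.
move=> km; rewrite (divn_eq k m.+1) expgnDr -[X in _ * heis_c ^+ X]mul1n !heis_cX_mul.
apply: leq_trans (word_lengthM _ _) _.
apply: leq_trans (leq_add (word_length_comm _ _) (word_length_comm _ _)) _.
have := ltn_pmod k (ltn0Sn m).
have : (k %/ m.+1 <= m.+1)%N 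
  by apply: leq_trans (leq_div2r m.+1 km) _; rewrite expnS expn1 mulnK.
lia.
Qed.

Definition zrange n : seq int := [seq (Posz i - Posz n)%R | i <- iota 0 (2 * n).+1].

Lemma mem_zrange n (i : int) : (`|i| <= Posz n)%R -> i \in zrange n.
Proof.
move=> ni; apply/mapP; exists (absz (i + Posz n)%R); last by lia.
by rewrite mem_iota; lia.
Qed.

Definition box n : seq triple :=
  [seq (ij, k) | ij <- [seq (i, j) | i <- zrange n, j <- zrange n], k <- zrange (n ^ 2)].

(** Enumerated through the coordinates, which lie in a box by [coord_bound]. *)
Definition wball n : seq heis :=
  [seq x <- undup [seq normal_form p | p <- box n] | (word_length x <= n)%N].

Lemma wball_uniq n : uniq (wball n).
Proof. exact/filter_uniq/undup_uniq. Qed.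

Lemma mem_wball n x : (x \in wball n) = (word_length x <= n)%N.
Proof.
rewrite mem_filter mem_undup andb_idr// => xn.
rewrite -[x]normal_formK; apply: map_f.
have [] := coord_bound x; case: (coord x) => [[i j] k]/= hi [hj hk].
by apply: allpairs_f; [apply: allpairs_f|]; apply: mem_zrange; nia.
Qed.

Lemma size_wball_le n : (size (wball n) <= 8 * n.+1 ^ 4)%N.
Proof.
rewrite size_filter; apply: leq_trans (count_size _ _) _.
apply: leq_trans (size_undup _) _.
rewrite size_map !size_allpairs !size_map !size_iota.
by rewrite !expnS expn0; nia.
Qed.

(** The elements b^j a^i c^k with i, j <= m and k <= m^2 are distinct and have
length at most m + m + 8m. *)
Lemma size_wball_ge m : (m.+1 ^ 4 <= 2 * size (wball (10 * m)))%N.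
Proof.
pose s := [seq (ij, k) | ij <- [seq (i, j) | i <- iota 0 m.+1, j <- iota 0 m.+1],
                         k <- iota 0 (m ^ 2).+1].
pose h (p : nat * nat * nat) := heis_b ^+ p.1.2 * heis_a ^+ p.1.1 * heis_c ^+ p.2.
have hE p : coord (h p) = (Posz p.1.1, Posz p.1.2, Posz p.2).
  rewrite !coordM coord_bX coord_aX coord_cX /tmul/=.
  by congr (_, _, _); ring.
have hinj : injective h.
  by move=> [[i j] k] [[i' j'] k'] /(congr1 coord); rewrite !hE/= => -[-> -> ->].
have : (size (map h s) <= size (wball (10 * m)))%N.
  apply: uniq_leq_size.
    rewrite map_inj_uniq//; apply: allpairs_uniq; rewrite ?iota_uniq//; last by case=> ? ? [].
    by apply: allpairs_uniq; rewrite ?iota_uniq//; case=> ? ? [].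
  move=> _ /mapP[p + ->]; rewrite /s => /allpairsP[[ij k] []].
  rewrite [(_, _).1]/= [(_, _).2]/= => + km ->.
  case/allpairsP=> [[i j] []]; rewrite [(_, _).1]/= [(_, _).2]/= => im jm ->.
  move: im jm km; rewrite !mem_iota => /andP[_ im] /andP[_ jm] /andP[_ km].
  rewrite mem_wball /h/=; apply: (@leq_trans (m + m + 8 * m)); last by lia.
  apply: leq_trans (word_lengthM _ _) (leq_add _ _); last exact: word_length_c_le.
  apply: leq_trans (word_lengthM _ _) (leq_add _ _).
    by apply: leq_trans (word_lengthX _ gen_b) _.
  by apply: leq_trans (word_lengthX _ gen_a) _.
rewrite size_map !size_allpairs !size_iota => H.
apply: leq_trans (leq_mul (leqnn 2) H).
by rewrite !expnS expn0; nia.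
Qed.

(** The size of a ball of radius n is of order (n + 1)^4 from both sides.  The
constant stays existential: its value, as a unary numeral, would be huge. *)
Lemma wball_doubling : exists2 K : nat, (0 < K)%N &
  forall n, (size (wball n) <= K * size (wball (n %/ 4)))%N.
Proof.
(* names the constant without letting it be computed *)
have [c cE] : {c : nat | c = (40 ^ 4)%N} by exists (40 ^ 4)%N.
have c0 : (0 < c)%N by rewrite cE expn_gt0.
exists (8 * (c * 2))%N => [|n]; first by rewrite !muln_gt0 c0.
set m := ((n %/ 4) %/ 10)%N.
have nm : (n.+1 <= 40 * m.+1)%N.
  by rewrite /m; lia.
have mn : (size (wball (10 * m)) <= size (wball (n %/ 4)))%N.
  apply: uniq_leq_size (wball_uniq _) _ => x; rewrite !mem_wball => /leq_trans; apply.
  by rewrite /m mulnC leq_trunc_div.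
apply: leq_trans (size_wball_le _) _; rewrite -!mulnA leq_pmul2l//.
have : (n.+1 ^ 4 <= (40 * m.+1) ^ 4)%N by rewrite leq_exp2r.
move/leq_trans; apply; rewrite expnMn -cE leq_pmul2l//.
by apply: leq_trans (size_wball_ge m) _; rewrite leq_pmul2l.
Qed.

End WordMetric.

(** * Finite configurations in Hilbert space *)

Section L2.
Context {R : realType}.
Notation leb := (@lebesgue_measure R).

Definition L2_dist_sqr (f g : L2 R) : \bar R := (\int[leb]_t ((f t - g t) ^+ 2)%:E)%E.

Lemma L2_measurable (f : L2 R) : measurable_fun setT (f : R -> R).
Proof. exact: (@measurable_funPT _ _ _ _ (repr (LebesgueSpace.sort f))). Qed.

Lemma Lnorm2_sqrt (h : R -> R) :
  ('N[leb]_2%:E[EFin \o h] = sqrte (\int[leb]_t ((h t) ^+ 2)%:E))%E.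
Proof.
rewrite unlock /Lnorm.
rewrite poweR12_sqrt; last by apply: integral_ge0 => t _; exact: poweR_ge0.
congr sqrte; apply: eq_integral => t _ /=.
by rewrite powR_mulrn// real_normK// num_real.
Qed.

Lemma L2_distE (f g : L2 R) : L2_dist f g = sqrte (L2_dist_sqr f g).
Proof. exact: Lnorm2_sqrt. Qed.

Lemma L2_dist_sqr_ge0 (f g : L2 R) : (0 <= L2_dist_sqr f g)%E.
Proof. by apply: integral_ge0 => t _; rewrite lee_fin sqr_ge0. Qed.

Lemma sqrte_sqr_EFin (a : R) : 0 <= a -> a%:E = sqrte (a ^+ 2)%:E.
Proof. by move=> a0; rewrite /sqrte/= sqrtr_sqr ger0_norm. Qed.

Lemma L2_dist_ge (a : R) (f g : L2 R) : 0 <= a ->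
  (a%:E <= L2_dist f g)%E = ((a ^+ 2)%:E <= L2_dist_sqr f g)%E.
Proof.
by move=> a0; rewrite L2_distE {1}sqrte_sqr_EFin// lee_sqrt// L2_dist_sqr_ge0.
Qed.

Lemma L2_dist_le (a : R) (f g : L2 R) : 0 <= a ->
  (L2_dist f g <= a%:E)%E = (L2_dist_sqr f g <= (a ^+ 2)%:E)%E.
Proof.
by move=> a0; rewrite L2_distE {1}(sqrte_sqr_EFin a0) lee_sqrt// lee_fin sqr_ge0.
Qed.

(** A quadratic inequality valid for real functions holds for functions with values
in L_2: apply it at each point of the line and integrate. *)
Lemma L2_transfer (X : Type) (f : X -> L2 R) (I J : eqType) (s : seq I) (t : seq J)
    (al : I -> R) (be : J -> R) (p q : I -> X) (p' q' : J -> X)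
    (lo : I -> R) (hi : J -> R) :
  (forall i, 0 <= al i) -> (forall j, 0 <= be j) ->
  (forall F : X -> R, \sum_(i <- s) al i * (F (p i) - F (q i)) ^+ 2 <=
                      \sum_(j <- t) be j * (F (p' j) - F (q' j)) ^+ 2) ->
  (forall i, i \in s -> 0 <= lo i /\ ((lo i)%:E <= L2_dist (f (p i)) (f (q i)))%E) ->
  (forall j, j \in t -> 0 <= hi j /\ (L2_dist (f (p' j)) (f (q' j)) <= (hi j)%:E)%E) ->
  \sum_(i <- s) al i * lo i ^+ 2 <= \sum_(j <- t) be j * hi j ^+ 2.
Proof.
move=> al0 be0 ineq lows his.
have mf x y : measurable_fun setT (fun u => ((f x u - f y u) ^+ 2)%:E).
  apply/measurable_EFinP; apply: measurable_funX.
  by apply: measurable_funB; exact: L2_measurable.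
have sumE (K : Type) (r : seq K) (ga : K -> R) (x y : K -> X) : (forall k, 0 <= ga k) ->
  (\int[leb]_u (\sum_(k <- r) ga k * (f (x k) u - f (y k) u) ^+ 2)%:E
   = \sum_(k <- r) (ga k)%:E * L2_dist_sqr (f (x k)) (f (y k)))%E.
  move=> ga0; under eq_integral do rewrite -sumEFin.
  rewrite ge0_integral_sum//.
  - apply: eq_bigr => k _; under eq_integral do rewrite EFinM.
    by rewrite ge0_integralZl_EFin// => u _; rewrite lee_fin sqr_ge0.
  - move=> k; under eq_fun do rewrite EFinM.
    exact: measurable_funeM.
  - by move=> k u _; rewrite lee_fin mulr_ge0// sqr_ge0.
have : (\sum_(i <- s) (al i)%:E * L2_dist_sqr (f (p i)) (f (q i)) <=
        \sum_(j <- t) (be j)%:E * L2_dist_sqr (f (p' j)) (f (q' j)))%E.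
  have msum (K : Type) (r : seq K) (ga : K -> R) (x y : K -> X) :
    measurable_fun setT (fun u => (\sum_(k <- r) ga k * (f (x k) u - f (y k) u) ^+ 2)%:E).
    under eq_fun do rewrite -sumEFin.
    apply: emeasurable_sum => k; under eq_fun do rewrite EFinM.
    exact: measurable_funeM.
  rewrite -!sumE//; apply: ge0_le_integral => //.
  - move=> u _; rewrite lee_fin sumr_ge0// => k _; by rewrite mulr_ge0// sqr_ge0.
  - by move=> u _; rewrite lee_fin; exact: (ineq (fun x => f x u)).
move=> main; rewrite -lee_fin -!sumEFin.
apply: le_trans (le_trans main _).
  rewrite big_seq [leRHS]big_seq; apply: lee_sum => i /lows[l0].
  by rewrite L2_dist_ge// => H; rewrite EFinM lee_wpmul2l ?lee_fin.
rewrite big_seq [leRHS]big_seq; apply: lee_sum => i /his[l0].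
by rewrite L2_dist_le// => H; rewrite EFinM lee_wpmul2l ?lee_fin.
Qed.

Definition cell (i : nat) : set R := `[i%:R, i.+1%:R[%classic.

Lemma cell_measure i : leb (cell i) = 1%E.
Proof.
rewrite /cell lebesgue_measure_itv/= lte_fin ltr_nat ltnSn.
by rewrite -EFinD -natr1 addrAC subrr add0r.
Qed.

Lemma cell_disjoint i j t : cell i t -> cell j t -> i = j.
Proof.
rewrite /cell/= !in_itv/= => /andP[it ti] /andP[jt tj].
apply/eqP; rewrite eqn_leq -ltnS -(ltr_nat R) (le_lt_trans it tj).
by rewrite -ltnS -(ltr_nat R) (le_lt_trans jt ti).
Qed.

(** The isometric copy of R^N in L_2 spanned by the indicators of unit cells. *)
Definition step N (w : nat -> R) (t : R) : R := \sum_(i < N) w i * \1_(cell i) t.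

Lemma step_sqr N w t : step N w t ^+ 2 = step N (fun i => w i ^+ 2) t.
Proof.
rewrite /step; case: (pselect (exists i : 'I_N, cell i t)) => [[i it]|no].
  have z (v : nat -> R) : \sum_(i < N) v i * \1_(cell i) t = v i.
    rewrite (bigD1 i)//= big1 ?addr0 => [|j ji].
      by rewrite indicE mem_set// mulr1.
    rewrite indicE memNset ?mulr0// => jt.
    by move/eqP: ji; apply; apply/val_inj/esym/(cell_disjoint it jt).
  by rewrite z (z (fun i => w i ^+ 2)).
rewrite !big1 ?expr0n// => i _.
  by rewrite indicE memNset ?mulr0// => it; apply: no; exists i.
by rewrite indicE memNset ?mulr0// => it; apply: no; exists i.
Qed.

Lemma measurable_step N w : measurable_fun setT (step N w).
Proof.
apply: measurable_sum => i; apply: measurable_funM => //.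
by apply: measurable_indic; exact: measurable_itv.
Qed.

Lemma integral_step_sqr N w :
  (\int[leb]_t ((step N w t) ^+ 2)%:E = (\sum_(i < N) w i ^+ 2)%:E)%E.
Proof.
under eq_integral do rewrite step_sqr /step -sumEFin.
have mc i : measurable (cell i) by exact: measurable_itv.
rewrite ge0_integral_sum//.
- rewrite -sumEFin; apply: eq_bigr => i _; under eq_integral do rewrite EFinM.
  rewrite ge0_integralZl_EFin ?sqr_ge0//.
  + have -> : (\int[leb]_x (\1_(cell i) x)%:E = leb (cell i `&` setT))%E.
      by apply: integral_indic; [exact: measurableT|exact: mc].
    by rewrite setIT cell_measure mule1.
  + by apply/measurable_EFinP; apply: measurable_indic; exact: mc.
- move=> i; apply/measurable_EFinP; apply: measurable_funM => //.
  by apply: measurable_indic; exact: mc.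
- by move=> i t _; rewrite lee_fin mulr_ge0// sqr_ge0.
Qed.

Lemma L2_of_fun (h : R -> R) :
  measurable_fun (setT : set (measurableTypeR R))
    (h : measurableTypeR R -> measurableTypeR R) ->
  (\int[leb]_t ((h t) ^+ 2)%:E < +oo)%E ->
  exists f : L2 R, ae_eq leb setT (f : R -> R) h.
Proof.
move=> mh hfin.
pose h0 : {mfun measurableTypeR R >-> measurableTypeR R} :=
  HB.pack (h : measurableTypeR R -> measurableTypeR R)
    (isMeasurableFun.Build _ _ (measurableTypeR R) (measurableTypeR R) h mh).
pose h1 : {mfun_ leb, measurableTypeR R >-> measurableTypeR R} :=
  \pi_({mfun_ leb, measurableTypeR R >-> measurableTypeR R})%qT h0.
have ae : ae_eq leb setT (h1 : R -> R) h.
  have : (repr h1 == h0 %[mod {mfun_ leb, measurableTypeR R >-> measurableTypeR R}])%qT.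
    by rewrite reprK.
  by rewrite eqmodE => /asboolP; apply: filterS => t H _; exact: H.
have fin : finite_norm leb 2%:E (h1 : R -> R).
  rewrite /finite_norm Lnorm2_sqrt.
  have -> : (\int[leb]_t ((h1 t) ^+ 2)%:E = \int[leb]_t ((h t) ^+ 2)%:E)%E.
    apply: ae_eq_integral => //.
    - apply/measurable_EFinP; apply: measurable_funX.
      exact: (@measurable_funPT _ _ _ _ (repr h1)).
    - by apply/measurable_EFinP; apply: measurable_funX.
    - by move: ae; apply: filterS => t /= H /H ->.
  have I0 : (0 <= \int[leb]_t ((h t) ^+ 2)%:E)%E.
    by apply: integral_ge0 => t _; rewrite lee_fin sqr_ge0.
  by rewrite -ge0_fin_numE ?sqrte_ge0// sqrte_fin_num// ge0_fin_numE.
pose f : L2 R := HB.pack h1 (isFinLebesgue.Build _ _ _ leb _ (lee1n 2) h1 fin).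
by exists f.
Qed.

Lemma L2_embed (X I : Type) (s : seq I) (v : X -> I -> R) :
  exists f : X -> L2 R, forall x y,
    L2_dist_sqr (f x) (f y) = (\sum_(i <- s) (v x i - v y i) ^+ 2)%:E.
Proof.
pose w x n := nth 0 [seq v x i | i <- s] n.
have /choice[f fP] x : exists f : L2 R, ae_eq leb setT (f : R -> R) (step (size s) (w x)).
  apply: L2_of_fun; first exact: measurable_step.
  by rewrite integral_step_sqr ltry.
exists f => x y.
have -> : \sum_(i <- s) (v x i - v y i) ^+ 2 = \sum_(i < size s) (w x i - w y i) ^+ 2.
  rewrite /w; case: (s) => [|i0 s']; first by rewrite big_nil big_ord0.
  rewrite (big_nth i0) big_mkord; apply: eq_bigr => i _.
  by rewrite !(nth_map i0).
rewrite -(integral_step_sqr _ (fun i => w x i - w y i)).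
have stepB t : step (size s) (fun i => w x i - w y i) t =
    step (size s) (w x) t - step (size s) (w y) t.
  by rewrite /step -sumrB; apply: eq_bigr => i _; rewrite mulrBl.
apply: ae_eq_integral => //.
- apply/measurable_EFinP; apply: measurable_funX.
  by apply: measurable_funB; exact: L2_measurable.
- by apply/measurable_EFinP; apply: measurable_funX; exact: measurable_step.
- move: (fP x) (fP y); apply: filterS2 => t /= Hx Hy /[dup] /Hx -> /Hy ->.
  by rewrite stepB.
Qed.

End L2.

(** * Lower bound on the distortion *)

Section Lower.
Context {R : realType}.

Lemma harm_ln n : ln n.+2%:R - 1 <= \sum_(0 <= k < n) k.+2%:R^-1 :> R.
Proof.
elim: n => [|n IH].
  by rewrite big_nil subr_le0 -[2]/(1 + 1); apply: le_ln1Dx; lra.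
rewrite big_nat_recr//=.
have x0 : 0 < n.+2%:R :> R by rewrite ltr0n.
have -> : n.+3%:R = n.+2%:R * (1 + n.+2%:R^-1) :> R.
  by rewrite mulrDr mulr1 mulfV ?gt_eqF// natr1.
have i0 : 0 < n.+2%:R^-1 :> R by rewrite invr_gt0.
rewrite lnM ?posrE ?addr_gt0//.
have ln1D_le (e : R) : 0 < e -> ln (1 + e) <= e by move=> ?; apply: le_ln1Dx; lra.
have := ln1D_le _ i0; move: IH.
move: (ln (1 + n.+2%:R^-1)) (ln n.+2%:R) => a b.
by move: (n.+2%:R^-1) (\sum_(0 <= k < n) _) => e S *; lra.
Qed.

Lemma fsum_ball (g : heis -> R) N :
  (forall x, g x != 0 -> (word_length x <= N)%N) ->
  \sum_(x \in [set: heis]) g x = \sum_(x <- wball N) g x.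
Proof.
move=> gN; rewrite -(@fsbig_widen _ _ _ _ [set` wball N])//.
  by rewrite [RHS]fsbig_seq//; exact: wball_uniq.
move=> x [_ /= xN]; apply/eqP; apply: contraT => /gN.
by rewrite -mem_wball.
Qed.

Lemma sum_const_seq (T : Type) (s : seq T) (c : R) :
  \sum_(x <- s) c = (size s)%:R * c.
Proof. by rewrite big_const_seq count_predT iter_addr addr0 mulr_natl. Qed.

Lemma ler_sum_subset (T : eqType) (s t : seq T) (g : T -> R) :
  uniq s -> uniq t -> {subset s <= t} -> (forall x, 0 <= g x) ->
  \sum_(x <- s) g x <= \sum_(x <- t) g x.
Proof.
move=> us ut st g0; rewrite (perm_big [seq x <- t | x \in s]).
  rewrite big_filter [leRHS](bigID (mem s))/= lerDl.
  exact: sumr_ge0.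
apply: uniq_perm => //; first exact: filter_uniq.
by move=> x; rewrite mem_filter andb_idr// => /st.
Qed.

(** A 1-Lipschitz function that is constant on the ball of radius 16m, so that
differences across central elements of length at most 8m from the ball of radius
8m are not affected, and that vanishes outside the ball of radius 32m. *)
Definition cutoff m (x : heis) : nat := minn (16 * m) (32 * m - word_length x).

Arguments cutoff m x%_g.

Lemma word_lengthMr_le x g : (word_length x <= word_length (x * g) + word_length g)%N.
Proof.
rewrite -[in leqLHS](mulgK g x) -[word_length g]word_lengthV; exact: word_lengthM.
Qed.

(** Subtracting F 1 makes the values of F on the ball of radius 32m differences of
values, hence at most 32m times the Lipschitz constant of F. *)
Definition localized m (F : heis -> R) (x : heis) : R :=
  (cutoff m x)%:R * (F x - F 1%g).

Lemma localized_supp m F x : localized m F x != 0 -> (word_length x <= 32 * m)%N.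
Proof.
rewrite /localized /cutoff; apply: contraNT; rewrite -ltnNge => /ltnW.
by rewrite -subn_eq0 => /eqP ->; rewrite minn0 mul0r.
Qed.

Lemma localized_plateau m F x k : x \in wball (8 * m) -> (k <= m ^ 2)%N ->
  localized m F (x * heis_c ^+ k)%g - localized m F x =
  (16 * m)%:R * (F (x * heis_c ^+ k)%g - F x).
Proof.
rewrite mem_wball => xm km; rewrite /localized.
have c1 : cutoff m x = (16 * m)%N by rewrite /cutoff; lia.
have c2 : cutoff m (x * heis_c ^+ k) = (16 * m)%N.
  have H w wc : (w <= word_length x + wc -> wc <= 8 * m ->
      minn (16 * m) (32 * m - w) = 16 * m)%N by lia.
  exact: H (word_lengthM _ _) (word_length_c_le km).
by rewrite c1 c2; ring.
Qed.

(** The Leibniz rule, with (p + q)^2 <= 2p^2 + 2q^2.  If one of the two points lies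
outside the ball of radius 32m, the cutoff vanishes at both. *)
Lemma localized_grad m F x g : g \in heis_gens ->
  (localized m F (x * g)%g - localized m F x) ^+ 2 <=
  if (word_length x <= 32 * m)%N && (word_length (x * g) <= 32 * m)%N then
    2 * (16 * m)%:R ^+ 2 * (F (x * g)%g - F x) ^+ 2 + 2 * (F x - F 1%g) ^+ 2
  else 0.
Proof.
move=> /word_length_gen g1.
have := word_lengthM x g; have := word_lengthMr_le x g.
rewrite /localized; set n := word_length x; set n' := word_length _ => h1 h2.
have cE : (cutoff m x <= cutoff m (x * g) + 1)%N && (cutoff m (x * g) <= cutoff m x + 1)%N.
  by rewrite /cutoff -/n -/n'; lia.
have cm : (cutoff m (x * g) <= 16 * m)%N by rewrite geq_minl.
case: ifPn => [_|]; last first.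
  rewrite negb_and -!ltnNge => H.
  have -> : cutoff m x = 0%N by rewrite /cutoff -/n; lia.
  have -> : cutoff m (x * g) = 0%N by rewrite /cutoff -/n'; lia.
  by rewrite !mul0r subrr expr0n.
move: (cutoff m x) (cutoff m (x * g)) cE cm => p q /andP[pq qp] qm.
have -> : q%:R * (F (x * g)%g - F 1%g) - p%:R * (F x - F 1%g) =
  q%:R * (F (x * g)%g - F x) + (q%:R - p%:R) * (F x - F 1%g) by ring.
move: (F (x * g)%g - F x) (F x - F 1%g) => y z.
have q2 : q%:R ^+ 2 <= (16 * m)%:R ^+ 2 :> R by rewrite -!natrX ler_nat leq_exp2r.
have d2 : (q%:R - p%:R) ^+ 2 <= 1 :> R.
  have pq' : p%:R <= q%:R + 1 :> R by rewrite natr1 ler_nat -addn1.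
  have qp' : q%:R <= p%:R + 1 :> R by rewrite natr1 ler_nat -addn1.
  rewrite -subr_ge0.
  have -> : 1 - (q%:R - p%:R) ^+ 2 = (p%:R + 1 - q%:R) * (q%:R + 1 - p%:R) :> R by ring.
  by rewrite mulr_ge0// subr_ge0.
move: q2 d2 (sqr_ge0 y) (sqr_ge0 z).
move: (q%:R) (q%:R - p%:R) ((16 * m)%:R) => a e c q2 d2 y2 z2.
have := ler_wpM2r y2 q2; have := ler_wpM2r z2 d2.
have : 0 <= (a * y - e * z) ^+ 2 by exact: sqr_ge0.
lra.
Qed.

(** [vertical_horizontal_fun] for the localized function, in a form that involves
only squares of differences of values of F, so that it can be integrated. *)
Lemma local_vertical_horizontal m (F : heis -> R) :
  \sum_(0 <= k < (m ^ 2).-1) \sum_(x <- wball (8 * m))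
    ((16 * m)%:R ^+ 2 / k.+2%:R ^+ 2) * (F (x * heis_c ^+ k.+2)%g - F x) ^+ 2
  <= \sum_(g <- [:: heis_a; heis_b]) \sum_(x <- wball (32 * m) | (word_length (x * g) <= 32 * m)%N)
    (54 * (16 * m)%:R ^+ 2 * (F (x * g)%g - F x) ^+ 2 + 54 * (F x - F 1%g) ^+ 2).
Proof.
pose u := localized m F.
have ufin : finite_set ((u : heis -> R^o) @^-1` [set~ 0]).
  apply: (@sub_finite_set _ _ [set` wball (32 * m)]); last exact: finite_seq.
  by move=> x /eqP /= ux; rewrite mem_wball; apply: localized_supp ux.
have := @vertical_horizontal_fun R heis heis_a heis_b heis_c u (m ^ 2).-1
  heis_c_central heis_ab ufin.
move=> main; apply: le_trans (le_trans main _).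
  apply: ler_sum_nat => k /andP[_ km].
  have {}km : (k.+2 <= m ^ 2)%N by lia.
  under eq_bigr do rewrite mulrAC.
  rewrite -mulr_suml ler_wpM2r ?invr_ge0 ?sqr_ge0//.
  rewrite (@fsum_ball _ (40 * m)); last first.
    move=> x; rewrite -mem_wball; apply: contraR => xm.
    have h : (40 * m < word_length x)%N by rewrite ltnNge -mem_wball.
    have ux : u x = 0.
      by apply/eqP; apply: contraT => /localized_supp; lia.
    have uxc : u (x * heis_c ^+ k.+2)%g = 0.
      apply/eqP; apply: contraT => /localized_supp.
      by have := word_lengthMr_le x (heis_c ^+ k.+2); have := word_length_c_le km; lia.
    by rewrite ux uxc subrr expr0n.
  have sub : {subset wball (8 * m) <= wball (40 * m)}.
    by move=> x; rewrite !mem_wball; lia.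
  apply: le_trans (ler_sum_subset (wball_uniq _) (wball_uniq _) sub _); last first.
    by move=> x; exact: sqr_ge0.
  rewrite big_seq [leRHS]big_seq; apply: ler_sum => x xm.
  by rewrite /u localized_plateau// exprMn.
have grad g : g \in heis_gens ->
  27 * \sum_(x \in [set: heis]) (u (x * g)%g - u x) ^+ 2 <=
  \sum_(x <- wball (32 * m) | (word_length (x * g) <= 32 * m)%N)
    (54 * (16 * m)%:R ^+ 2 * (F (x * g)%g - F x) ^+ 2 + 54 * (F x - F 1%g) ^+ 2).
  move=> gg; rewrite (@fsum_ball _ (32 * m)); last first.
    move=> x; apply: contraR => xm; apply/eqP/le_anti; rewrite sqr_ge0 andbT.
    by apply: le_trans (localized_grad m F x gg) _; rewrite (negbTE xm).
  rewrite mulr_sumr [leRHS]big_mkcond/= big_seq [leRHS]big_seq; apply: ler_sum => x.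
  rewrite mem_wball => xm; have := localized_grad m F x gg; rewrite xm/=.
  by case: ifP => _; rewrite -/u; lra.
rewrite mulrDr !big_cons big_nil addr0.
by apply: lerD; apply: grad; rewrite ?gen_a ?gen_b.
Qed.

(** In the inequality for f, a central difference at c^k is at least the length of
c^k, whose square is at least k, and horizontal differences are at most D or, for
the differences with the value at 1, at most D times the radius.  The
volumes of the balls of radii 8m and 32m cancel up to the factor K. *)
Lemma distortion_lower_core (K : nat) (f : heis -> L2 R) (D : R) m :
  (forall n, (size (wball n) <= K * size (wball (n %/ 4)))%N) ->
  (0 < m)%N -> 0 <= D ->
  (forall x y, (word_length x <= 32 * m)%N -> (word_length y <= 32 * m)%N ->
     ((dW x y)%:R%:E <= L2_dist (f x) (f y))%E /\
     (L2_dist (f x) (f y) <= (D * (dW x y)%:R)%:E)%E) ->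
  ln (m ^ 2)%:R - 1 <= 540 * K%:R * D ^+ 2.
Proof.
move=> doubling m0 D0 fP.
pose s := [seq (k, x) | k <- index_iota 0 (m ^ 2).-1, x <- wball (8 * m)].
pose P := [seq (g, x) | g <- [:: heis_a; heis_b],
                        x <- [seq x <- wball (32 * m) | (word_length (x * g) <= 32 * m)%N]].
(* horizontal differences (true) and differences with the value at 1 (false), over the same edges *)
pose t := [seq (true, p) | p <- P] ++ [seq (false, p) | p <- P].
have PP p : p \in P -> [/\ p.1 \in heis_gens, (word_length p.2 <= 32 * m)%N &
    (word_length (p.2 * p.1) <= 32 * m)%N].
  case/allpairsPdep => g [x [gg]]; rewrite mem_filter mem_wball => /andP[xg xm] -> /=.
  split=> //; move: gg; rewrite !inE => /orP[] /eqP ->; rewrite eqxx ?orbT//.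
have main : \sum_(i <- s) (16 * m)%:R ^+ 2 / i.1.+2%:R ^+ 2 * (word_length (heis_c ^+ i.1.+2))%:R ^+ 2
    <= \sum_(j <- t) (if j.1 then 54 * (16 * m)%:R ^+ 2 else 54) *
    (if j.1 then D else D * (32 * m)%:R) ^+ 2.
  apply: (@L2_transfer R heis f _ _ s t _ _
    (fun i => (i.2 * heis_c ^+ i.1.+2)%g) (fun i => i.2)
    (fun j => if j.1 then (j.2.2 * j.2.1)%g else j.2.2)
    (fun j => if j.1 then j.2.2 else 1%g)) => [i|[[] j]|F|i|j].
  - by rewrite mulr_ge0 ?invr_ge0 ?sqr_ge0.
  - by rewrite mulr_ge0 ?sqr_ge0.
  - by [].
  - rewrite big_allpairs/=.
    apply: le_trans (local_vertical_horizontal m F) _.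
    rewrite /t big_cat/= !big_map/= -big_split/= /P big_allpairs_dep/=.
    by rewrite le_eqVlt; apply/orP; left; apply/eqP; apply: eq_bigr => g _; rewrite big_filter.
  - case: i => k x /allpairsP[[k' x'] /= [+ + [-> ->]]].
    rewrite mem_index_iota mem_wball => /andP[_ km] xm.
    have {}km : (k'.+2 <= m ^ 2)%N by lia.
    split=> //; have [] := fP (x' * heis_c ^+ k'.+2)%g x'.
    + apply: leq_trans (word_lengthM _ _) _.
      by apply: leq_trans (leq_add xm (word_length_c_le km)) _; lia.
    + lia.
    + by rewrite dW_sym dW_mulr.
  - rewrite mem_cat => /orP[] /mapP[p /PP[gg x1 x2] ->] /=; split=> //.
    + have [_] := fP _ _ x2 x1; move/le_trans; apply.
      by rewrite dW_sym dW_mulr lee_fin ler_piMr// lern1; exact: word_length_gen.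
    + by rewrite mulr_ge0.
    + have [|_] := fP p.2 1%g x1; first by rewrite word_length1.
      move/le_trans; apply; rewrite dW_sym dW1 lee_fin ler_wpM2l// ler_nat//.
have m1 : 0 < (16 * m)%:R ^+ 2 :> R by rewrite exprn_gt0// ltr0n muln_gt0.
have V0 : 0 < (size (wball (8 * m)))%:R :> R.
  rewrite ltr0n; case E : (wball _) => //; have : 1%g \in wball (8 * m).
    by rewrite mem_wball word_length1.
  by rewrite E.
have sizeP : (size P)%:R <= 2 * K%:R * (size (wball (8 * m)))%:R :> R.
  rewrite -!natrM ler_nat /P size_allpairs_dep/= addn0 -mulnA mul2n -addnn.
  have le1 (g : heis) : (size [seq x <- wball (32 * m) | (word_length (x * g) <= 32 * m)%N] <= K * size (wball (8 * m)))%N.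
    rewrite size_filter; apply: leq_trans (count_size _ _) _.
    apply: leq_trans (doubling _) _; rewrite (_ : (32 * m) %/ 4 = 8 * m)%N//; lia.
  exact: leq_add.
have lhs : (size (wball (8 * m)))%:R * (16 * m)%:R ^+ 2 * (ln (m ^ 2)%:R - 1) <=
  \sum_(i <- s) (16 * m)%:R ^+ 2 / i.1.+2%:R ^+ 2 * (word_length (heis_c ^+ i.1.+2))%:R ^+ 2 :> R.
  have h := harm_ln (m ^ 2).-1.
  have {h} : ln (m ^ 2)%:R - 1 <= \sum_(0 <= k < (m ^ 2).-1) k.+2%:R^-1 :> R.
    apply: le_trans h; rewrite lerB// ler_ln ?posrE ?ltr0n ?expn_gt0 ?m0// ler_nat; lia.
  move/(ler_wpM2l (ltW (mulr_gt0 V0 m1))); move/le_trans; apply.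
  rewrite /s big_allpairs/= mulr_sumr; apply: ler_sum_nat => k _.
  rewrite sum_const_seq -[leLHS]mulrA ler_wpM2l//.
  rewrite -[leRHS]mulrA (ler_wpM2l (ltW m1))//.
  rewrite ler_pdivlMl ?exprn_gt0// expr2 mulfK ?pnatr_eq0// -natrX ler_nat.
  exact: word_length_c_ge.
have rhs : \sum_(j <- t) (if j.1 then 54 * (16 * m)%:R ^+ 2 else 54) *
    (if j.1 then D else D * (32 * m)%:R) ^+ 2 = (size P)%:R * (270 * (16 * m)%:R ^+ 2 * D ^+ 2).
  rewrite /t big_cat/= !big_map/= !sum_const_seq.
  rewrite -mulrDr; congr (_ * _); rewrite (_ : 32 * m = 2 * (16 * m))%N; last by lia.
  by rewrite natrM; ring.
rewrite rhs in main; move: (le_trans lhs main) => {}main.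
have : (size P)%:R * (270 * (16 * m)%:R ^+ 2 * D ^+ 2) <=
   (size (wball (8 * m)))%:R * (16 * m)%:R ^+ 2 * (540 * K%:R * D ^+ 2).
  apply: le_trans (ler_wpM2r _ sizeP) _; first by rewrite !mulr_ge0// sqr_ge0.
  by rewrite le_eqVlt; apply/orP; left; apply/eqP; ring.
move/(le_trans main); rewrite ler_pM2l//; exact: mulr_gt0.
Qed.

End Lower.

(** * Upper bound on the distortion *)

Section Upper.
Context {R : realType}.

Definition vol n : R := (size (wball n))%:R.

Lemma vol_gt0 n : 0 < vol n.
Proof.
rewrite ltr0n; have : 1%g \in wball n by rewrite mem_wball word_length1.
by case: (wball n).
Qed.

(** Dividing by the square root of the volume makes the l_2 norm of a bump of
height n of order n. *)
Definition bump n (x z : heis) : R := (n - dW x z)%:R / Num.sqrt (vol n).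

Lemma sum_near_le n x (s : seq heis) : uniq s ->
  \sum_(z <- s) ((dW x z <= n)%N)%:R <= vol n.
Proof.
move=> us.
have -> : \sum_(z <- s) ((dW x z <= n)%N)%:R = (count (fun z => dW x z <= n)%N s)%:R :> R.
  by elim: (s) => [|z s' IH]; rewrite ?big_nil// big_cons IH -natrD.
rewrite ler_nat -size_filter.
rewrite -(size_map (fun z => x^-1 * z)%g); apply: uniq_leq_size.
  by rewrite map_inj_uniq ?filter_uniq//; exact: mulgI.
by move=> _ /mapP[z + ->]; rewrite mem_filter => /andP[xz _]; rewrite mem_wball.
Qed.

(** Pointwise the difference is at most d(x, y), and it vanishes off the balls of
radius n around x and y. *)
Lemma bump_lip n x y (s : seq heis) : uniq s ->
  \sum_(z <- s) (bump n x z - bump n y z) ^+ 2 <= 2 * (dW x y)%:R ^+ 2.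
Proof.
move=> us; set d := dW x y.
have pt z : (bump n x z - bump n y z) ^+ 2 <=
   d%:R ^+ 2 / vol n * ((dW x z <= n)%N%:R + (dW y z <= n)%N%:R).
  have v0 := ltW (vol_gt0 n).
  rewrite /bump -mulrBl exprMn exprVn sqr_sqrtr//.
  rewrite [d%:R ^+ 2 / _]mulrC -[leRHS]mulrA mulrC ler_wpM2l ?invr_ge0//.
  have h1 := dW_triangle y x z; have h2 := dW_triangle x y z.
  rewrite [dW y x]dW_sym -/d in h2; rewrite -/d in h1.
  move: (dW x z) (dW y z) h1 h2 => p q h1 h2.
  have [pn|np] := leqP p n.
    apply: (@le_trans _ _ (d%:R ^+ 2)); last first.
      by rewrite ler_peMr ?sqr_ge0// lerDl.
    have e1 : (n - p)%:R <= (n - q)%:R + d%:R :> R by rewrite -natrD ler_nat; lia.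
    have e2 : (n - q)%:R <= (n - p)%:R + d%:R :> R by rewrite -natrD ler_nat; lia.
    rewrite -subr_ge0 subr_sqr mulr_ge0//; lra.
  have [qn|nq] := leqP q n.
    apply: (@le_trans _ _ (d%:R ^+ 2)); last first.
      by rewrite ler_peMr ?sqr_ge0// lerDr.
    have e1 : (n - p)%:R <= (n - q)%:R + d%:R :> R by rewrite -natrD ler_nat; lia.
    have e2 : (n - q)%:R <= (n - p)%:R + d%:R :> R by rewrite -natrD ler_nat; lia.
    rewrite -subr_ge0 subr_sqr mulr_ge0//; lra.
  have -> : (n - p = 0)%N by lia.
  have -> : (n - q = 0)%N by lia.
  by rewrite subrr expr0n addr0 mulr0.
apply: (@le_trans _ _ (\sum_(z <- s) d%:R ^+ 2 / vol n *
    ((dW x z <= n)%N%:R + (dW y z <= n)%N%:R))).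
  by apply: ler_sum => z _; exact: pt.
rewrite -mulr_sumr big_split/=.
have := lerD (sum_near_le n x us) (sum_near_le n y us).
have c0 : 0 <= d%:R ^+ 2 / vol n by rewrite mulr_ge0 ?sqr_ge0// invr_ge0 (ltW (vol_gt0 _)).
move/(ler_wpM2l c0)/le_trans; apply.
by rewrite -mulrA mulrDr mulVf ?gt_eqF ?vol_gt0// mulrC.
Qed.

(** On the ball of radius n/4 around x the first bump is at least 3n/4 and the
second at most n/4. *)
Lemma bump_sep n x y (s : seq heis) : uniq s -> (n <= dW x y)%N ->
  (forall h, (word_length h <= n %/ 4)%N -> (x * h)%g \in s) ->
  vol (n %/ 4) * (n%:R ^+ 2 / 4 / vol n) <= \sum_(z <- s) (bump n x z - bump n y z) ^+ 2.
Proof.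
move=> us nd hs.
pose t := [seq (x * h)%g | h <- wball (n %/ 4)].
apply: (@le_trans _ _ (\sum_(z <- t) (bump n x z - bump n y z) ^+ 2)); last first.
  apply: ler_sum_subset => //.
  - by rewrite map_inj_uniq ?wball_uniq//; exact: mulgI.
  - by move=> _ /mapP[h + ->]; rewrite mem_wball => /hs.
  - by move=> z; exact: sqr_ge0.
rewrite big_map /vol -sum1_size natr_sum mulr_suml big_seq [leRHS]big_seq.
apply: ler_sum => h; rewrite mem_wball mul1r => hn.
have v0 := ltW (vol_gt0 n).
rewrite /bump -mulrBl exprMn exprVn sqr_sqrtr// -/(vol n).
rewrite ler_wpM2r ?invr_ge0//.
have h1 : dW x (x * h) = word_length h by rewrite dW_mulr.
have h2 := dW_triangle (x * h)%g x y.
rewrite h1 [dW (x * h) y]dW_sym in h2; rewrite h1.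
move: (dW y _) h2 => q h2.
have e : n%:R / 2 <= (n - word_length h)%:R - (n - q)%:R :> R.
  rewrite ler_pdivrMr// mulrBl lerBrDr -!natrM -natrD ler_nat; lia.
have n0 : 0 <= n%:R / 2 :> R by rewrite mulr_ge0// invr_ge0.
have -> : n%:R ^+ 2 / 4 = (n%:R / 2) ^+ 2 :> R by field.
by rewrite ler_pXn2r// nnegrE// (le_trans n0).
Qed.

Lemma ln2_gt0 : 0 < ln 2 :> R.
Proof. by rewrite ln_gt0// ltr1n. Qed.

(** The embedding is the orthogonal sum of the bump maps over the scales 2^k, k < L,
with 2^L just above twice the radius, rescaled by sqrt (16 K) so as not to
contract any distance. *)
Lemma distortion_upper (K : nat) (r : R) : (0 < K)%N -> 2 <= r ->
  (forall n, (size (wball n) <= K * size (wball (n %/ 4)))%N) ->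
  (heis_distortion r <= (Num.sqrt (96 * K%:R / ln 2) * Num.sqrt (ln r))%:E)%E.
Proof.
move=> K0 r2 doubling.
have r0 : 0 <= r by lra.
pose m := Num.truncn r.
have mr : m%:R <= r by rewrite truncn_le.
have m2 : (2 <= m)%N by rewrite truncn_ge_nat.
have wm x : heis_ball r x -> (word_length x <= m)%N.
  by rewrite /heis_ball/= dW1 truncn_ge_nat.
pose L := (trunc_log 2 (2 * m)).+1.
have Lr : L%:R <= 3 * ln r / ln 2.
  rewrite ler_pdivlMr ?ln2_gt0//.
  have : (2 ^ trunc_log 2 (2 * m) <= 2 * m)%N by apply: trunc_logP; lia.
  rewrite -(ler_nat R) natrX natrM => H.
  have {H} : 2 ^+ trunc_log 2 (2 * m) <= 2 * r by apply: le_trans H _; rewrite ler_wpM2l.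
  rewrite -ler_ln ?posrE ?exprn_gt0 ?mulr_gt0//; last by lra.
  rewrite lnXn// lnM ?posrE//; last by lra.
  have : ln 2 <= ln r by rewrite ler_ln ?posrE//; lra.
  rewrite /L -natr1 mulrDl mul1r -mulr_natl; lra.
pose s := [seq (k, z) | k <- index_iota 0 L, z <- wball (2 * m)].
pose C : R := Num.sqrt (16 * K%:R).
have C2 : C ^+ 2 = 16 * K%:R by rewrite sqr_sqrtr// mulr_ge0.
have KR : 1 <= K%:R :> R by rewrite ler1n.
have L1 : 1 <= L%:R :> R by rewrite ler1n.
have [f fE] := @L2_embed R {x : heis | heis_ball r x} (nat * heis) s
  (fun x i => C * bump (2 ^ i.1) (sval x) i.2).
have {}fE x y : L2_dist_sqr (f x) (f y) = (16 * K%:R * \sum_(0 <= k < L) \sum_(z <- wball (2 * m))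
    (bump (2 ^ k) (sval x) z - bump (2 ^ k) (sval y) z) ^+ 2)%:E.
  rewrite fE big_allpairs/= -C2 mulr_sumr; congr (_%:E); apply: eq_bigr => k _.
  by rewrite mulr_sumr; apply: eq_bigr => z _; rewrite -mulrBr exprMn.
pose D : R := Num.sqrt (32 * K%:R * L%:R).
have D2 : D ^+ 2 = 32 * K%:R * L%:R by rewrite sqr_sqrtr// !mulr_ge0.
have D1 : 1 <= D.
  rewrite -sqrtr1 ler_sqrt ?mulr_ge0//.
  have : 1 <= K%:R * L%:R :> R by rewrite mulr_ege1.
  by rewrite -mulrA; lra.
apply: (@le_trans _ _ D%:E); last first.
  rewrite lee_fin -sqrtrM; last by rewrite !mulr_ge0// invr_ge0 (ltW ln2_gt0).
  rewrite ler_sqrt; last first.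
    by rewrite !mulr_ge0 ?invr_ge0 ?ln_ge0 ?(ltW ln2_gt0)//; lra.
  have -> : 96 * K%:R / ln 2 * ln r = 32 * K%:R * (3 * ln r / ln 2) :> R.
    by have := ln2_gt0 => ?; field; rewrite gt_eqF.
  by rewrite ler_wpM2l// mulr_ge0.
apply: ereal_inf_lbound; exists D => //; split => //; exists f => x y.
have dm : (dW (sval x) (sval y) <= 2 * m)%N.
  apply: leq_trans (dW_triangle 1%g _ _) _; rewrite dW_sym !dW1.
  by have := wm _ (svalP x); have := wm _ (svalP y); lia.
set d := dW _ _ in dm *.
rewrite L2_dist_ge// L2_dist_le ?mulr_ge0 ?(le_trans _ D1)// !fE !lee_fin.
split.
  have [->|d0] := posnP d.
    rewrite expr0n/= !mulr_ge0//; apply: sumr_ge0 => k _.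
    by apply: sumr_ge0 => z _; exact: sqr_ge0.
  have /andP[kd dk] := trunc_log_bounds (isT : 1 < 2)%N d0.
  set k := trunc_log 2 d in kd dk.
  (* the scale of the pair x, y alone already gives the lower estimate *)
  have kL : (k < L)%N by rewrite ltnS leq_trunc_log.
  have sep : vol (2 ^ k %/ 4) * ((2 ^ k)%:R ^+ 2 / 4 / vol (2 ^ k)) <=
      \sum_(0 <= k < L) \sum_(z <- wball (2 * m)) (bump (2 ^ k) (sval x) z - bump (2 ^ k) (sval y) z) ^+ 2.
    rewrite (bigD1_seq k) ?mem_index_iota ?iota_uniq//=.
    rewrite -[X in X <= _]addr0 lerD//.
      apply: bump_sep => //; first exact: wball_uniq.
      move=> h hk; rewrite mem_wball; apply: leq_trans (word_lengthM _ _) _.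
      by have := wm _ (svalP x); lia.
    by apply: sumr_ge0 => j _; apply: sumr_ge0 => z _; exact: sqr_ge0.
  have volK : vol (2 ^ k) <= K%:R * vol (2 ^ k %/ 4) by rewrite -natrM ler_nat doubling.
  have dk2 : d%:R <= 2 * (2 ^ k)%:R :> R by rewrite -natrM ler_nat -expnS ltnW.
  have c16 : 0 <= 16 * K%:R :> R by rewrite mulr_ge0.
  apply: le_trans (ler_wpM2l c16 sep).
  have v0 := vol_gt0 (2 ^ k).
  have regroup (a b c e : R) : e != 0 ->
      16 * a * (b * (c ^+ 2 / 4 / e)) = a * b * (4 * c ^+ 2) / e.
    by move=> e0; field.
  rewrite regroup ?gt_eqF//.
  rewrite ler_pdivlMr// mulrC; apply: ler_pM volK _; [exact: ltW|exact: sqr_ge0|].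
  have -> : 4 * (2 ^ k)%:R ^+ 2 = (2 * (2 ^ k)%:R) ^+ 2 :> R.
    by rewrite exprMn; congr (_ * _); rewrite -natrX.
  by rewrite ler_pXn2r ?nnegrE ?mulr_ge0.
rewrite exprMn D2.
apply: (@le_trans _ _ (16 * K%:R * (L%:R * (2 * d%:R ^+ 2)))); last first.
  by rewrite le_eqVlt; apply/orP; left; apply/eqP; ring.
rewrite ler_wpM2l ?mulr_ge0//.
apply: (@le_trans _ _ (\sum_(0 <= k < L) 2 * d%:R ^+ 2)).
  by apply: ler_sum => k _; apply: bump_lip; exact: wball_uniq.
by rewrite sum_const_seq size_iota subn0.
Qed.
End Upper.

(** * Distortion of balls *)

(** [distortion_lower_core] with 32m just below r; for r < 32 the bound only says
that a distortion is at least 1. *)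
Lemma ln_le_distortion (R : realType) (K : nat) (r D : R)
    (f : {x : heis | heis_ball r x} -> L2 R) : (0 < K)%N -> 2 <= r -> 1 <= D ->
  (forall n, (size (wball n) <= K * size (wball (n %/ 4)))%N) ->
  (forall x y, ((dW (sval x) (sval y))%:R%:E <= L2_dist (f x) (f y))%E /\
     (L2_dist (f x) (f y) <= (D * (dW (sval x) (sval y))%:R)%:E)%E) ->
  ln r <= (ln 64 + 1 + 270 * K%:R) * D ^+ 2.
Proof.
move=> K0 r2 D1 doubling fP.
have D2 : 1 <= D ^+ 2 by rewrite expr_ge1// (le_trans _ D1).
have l64 : 0 <= ln 64 :> R by rewrite ln_ge0// ler1n.
have KR : 0 <= K%:R :> R by [].
pose m := Num.truncn (r / 32).
have r32 : 0 <= r / 32 by lra.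
have rm : r < 32 * m.+1%:R.
  by have := truncnS_gt (r / 32); rewrite -/m ltr_pdivrMr// mulrC.
have [m0|m0] := posnP m.
  have lnr : ln r <= ln 64 by rewrite ler_ln ?posrE//; move: rm; rewrite m0; lra.
  apply: (le_trans lnr); apply: (@le_trans _ _ (ln 64 + 1 + 270 * K%:R)); first by lra.
  by rewrite ler_peMr//; lra.
have mr : (32 * m)%:R <= r.
  by rewrite natrM mulrC -ler_pdivlMr// truncn_le.
have b1 : heis_ball r 1%g by rewrite /heis_ball/= dW1 word_length1; lra.
pose f' x : L2 R := match pselect (heis_ball r x) with
  | left p => f (exist _ x p) | right _ => f (exist _ 1%g b1) end.
have f'P x y : (word_length x <= 32 * m)%N -> (word_length y <= 32 * m)%N ->
     ((dW x y)%:R%:E <= L2_dist (f' x) (f' y))%E /\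
     (L2_dist (f' x) (f' y) <= (D * (dW x y)%:R)%:E)%E.
  have inb z : (word_length z <= 32 * m)%N -> heis_ball r z.
    by move=> zm; rewrite /heis_ball/= dW1 (le_trans _ mr)// ler_nat.
  move=> /inb xb /inb yb; rewrite /f'.
  case: pselect => // px; case: pselect => // py; exact: fP.
have := distortion_lower_core doubling m0 (le_trans ler01 D1) f'P.
have mR : 0 < m%:R :> R by rewrite ltr0n.
rewrite natrX lnXn// => H.
have lnr : ln r <= ln 64 + ln m%:R.
  rewrite -lnM ?posrE// ler_ln ?posrE ?mulr_gt0//; last by lra.
  have m1 : 1 <= m%:R :> R by rewrite ler1n.
  by move: rm; rewrite -natr1; lra.
apply: (le_trans lnr).
have := mulr_ge0 l64 (ltW (lt_le_trans ltr01 D2)).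
have : 0 <= ln 64 * (D ^+ 2 - 1) :> R by rewrite mulr_ge0// subr_ge0.
move: H; rewrite mulr2n; move: (ln m%:R) (D ^+ 2) D2 => l d2 D2.
have : 0 <= K%:R * d2 by rewrite mulr_ge0//; lra.
move: (K%:R * d2) => kd.
lra.
Qed.

Theorem corollary1p6 (R : realType) :
  exists kappa A : R, 0 < kappa /\ kappa <= A /\
    forall r : R, 2 <= r ->
      ((kappa * Num.sqrt (ln r))%:E <= heis_distortion r)%E /\
      (heis_distortion r <= (A * Num.sqrt (ln r))%:E)%E.
Proof.
have [K K0 doubling] := wball_doubling.
pose C : R := ln 64 + 1 + 270 * K%:R.
have C0 : 0 < C.
  have : 0 <= ln 64 :> R by rewrite ln_ge0// ler1n.
  have : 0 <= K%:R :> R by [].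
  by rewrite /C; lra.
pose kappa := (Num.sqrt C)^-1.
have kappa0 : 0 < kappa by rewrite invr_gt0 sqrtr_gt0.
exists kappa, (Num.max kappa (Num.sqrt (96 * K%:R / ln 2))).
split=> //; split; first by rewrite le_max lexx.
move=> r r2; split; last first.
  apply: (le_trans (distortion_upper K0 r2 doubling)).
  by rewrite lee_fin ler_wpM2r ?sqrtr_ge0// le_max lexx orbT.
apply: le_ereal_inf_tmp => _ [D [D1 [f fP]] <-].
have lnr := ln_le_distortion K0 r2 D1 doubling fP.
rewrite lee_fin /kappa ler_pdivrMl ?sqrtr_gt0//.
have D0 : 0 <= D by apply: le_trans D1.
rewrite -[D in leRHS](ger0_norm D0) -sqrtr_sqr -sqrtrM ?(ltW C0)//.
exact: ler_wsqrtr.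
Qed.
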